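(* Let $d\ge 2$ and let $\mu$ be a radius law on $\mathbb{R}_+$. Suppose that there exists $c>0$ such that $\mu([r,\infty))\le \exp(-cr)$ for every $r\ge1$. Then, for every $\lambda<\widetilde\lambda_c$, there exists $c_\lambda>0$ such that for every $r\ge1$, $$\theta_r(\lambda)\le\exp(-c_\lambda r).$$
   Context: Let $d\ge2$; $\mathbb{R}^d$ carries the Euclidean norm $\|\cdot\|$. For $x\in\mathbb{R}^d$, $r>0$: $\mathsf B_r^x=\{y:\|y-x\|\le r\}$, $\partial\mathsf B_r^x=\{y:\|y-x\|=r\}$, $\mathsf B_r=\mathsf B_r^0$, $\partial\mathsf B_r=\partial\mathsf B_r^0$. The radius law $\mu$ is a finite measure on $\mathbb{R}_+=[0,\infty)$. For $\lambda>0$, $\mathbb{P}_\lambda$ is the law of a Poisson point process $\eta$ on $\mathbb{R}^d\times\mathbb{R}_+$ with intensity $\lambda\cdot dz\otimes\mu$ ($dz$ = Lebesgue measure); for $\lambda=0$, $\eta=\emptyset$; only $\lambda\ge 0$ is considered. Set $\mathcal O(\eta)=\bigcup_{(z,R)\in\eta}\mathsf B_R^z$ (Poisson-Boolean percolation). Two points $x,y$ are connected, written $x\longleftrightarrow y$, if there is a continuous path in $\mathcal O(\eta)$ from $x$ to $y$. For $X,Y\subset\mathbb{R}^d$, $X\longleftrightarrow Y$ means that some $x\in X$ is connected to some $y\in Y$; one writes $x\longleftrightarrow Y$ if $X=\{x\}$. Define $\theta_r(\lambda)=\mathbb{P}_\lambda[0\longleftrightarrow\partial\mathsf B_r]$ and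 $$\widetilde\lambda_c=\inf\{\lambda\ge0:\inf_{r>0}\mathbb{P}_\lambda[\mathsf B_r\longleftrightarrow\partial\mathsf B_{2r}]>0\}.$$ *)

(* Defs.v *)
From HB Require Import structures.
From mathcomp Require Import all_boot all_order all_algebra.
From mathcomp Require Import all_classical all_reals all_analysis.
From mathcomp Require Import measurable_realfun.
Import Order.TTheory GRing.Theory Num.Theory.
Import numFieldNormedType.Exports.

Set Implicit Arguments.
Unset Strict Implicit.
Unset Printing Implicit Defensive.

Local Open Scope classical_set_scope.
Local Open Scope ring_scope.

(* As for tuples in the library, 'rV[R]_d carries the sigma-algebra generated
   by its coordinates, which is the Borel sigma-algebra of R^d. *)
Section measurable_rV.
Context (R : realType) (d : nat).

Definition rV_coord (i : 'I_d) (x : 'rV[R]_d) : R := x ord0 i.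

Let rV_set0 : g_sigma_preimage rV_coord set0.
Proof. exact: sigma_algebra0. Qed.

Let rV_setC A : g_sigma_preimage rV_coord A -> g_sigma_preimage rV_coord (~` A).
Proof. exact: sigma_algebraC. Qed.

Let rV_bigcup (F : _^nat) : (forall i, g_sigma_preimage rV_coord (F i)) ->
  g_sigma_preimage rV_coord (\bigcup_i (F i)).
Proof. exact: sigma_algebra_bigcup. Qed.

HB.instance Definition _ := @isMeasurable.Build default_measure_display
  'rV[R]_d (g_sigma_preimage rV_coord) rV_set0 rV_setC rV_bigcup.

Lemma measurable_rV_coord (i : 'I_d) : measurable_fun setT (rV_coord i).
Proof.
move=> _ Y mY; rewrite setTI; apply: sub_sigma_algebra => /=.
rewrite -bigcup_seq/=; exists i => /=; first by rewrite mem_index_enum.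
by exists Y => //; rewrite setTI.
Qed.

Lemma measurable_fun_rVP d1 (T1 : measurableType d1) (f : T1 -> 'rV[R]_d) :
  (forall i, measurable_fun setT (fun t => rV_coord i (f t))) ->
  measurable_fun setT f.
Proof.
move=> mf _ A mA; rewrite setTI; move: A mA.
apply: smallest_sub.
  split => /=.
  - by rewrite preimage_set0.
  - by move=> A mA; rewrite setTD preimage_setC; exact: measurableC.
  - by move=> F mF; rewrite preimage_bigcup; exact: bigcup_measurable.
rewrite -bigcup_seq/=; apply: bigcup_sub => i _ A [B mB <-] /=.
by rewrite setTI -(setTI (_ @^-1` _)); exact: (mf i).
Qed.

End measurable_rV.

Section lebesgue_rV_step.
Context (R : realType) (d : nat).
Variable m : {sigma_finite_measure set 'rV[R]_d -> \bar R}.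

Definition rV_cons (p : measurableTypeR R * 'rV[R]_d) : 'rV[R]_d.+1 :=
  \row_i (if unlift ord0 i is Some j then p.2 ord0 j else p.1).

Definition rV_uncons (x : 'rV[R]_d.+1) : measurableTypeR R * 'rV[R]_d :=
  (x ord0 ord0, \row_i x ord0 (lift ord0 i)).

Lemma rV_cons0 p : rV_cons p ord0 ord0 = p.1.
Proof. by rewrite mxE unlift_none. Qed.

Lemma rV_consS p i : rV_cons p ord0 (lift ord0 i) = p.2 ord0 i.
Proof. by rewrite mxE liftK. Qed.

Lemma rV_consK : cancel rV_cons rV_uncons.
Proof.
move=> p; rewrite /rV_uncons rV_cons0 [RHS]surjective_pairing; congr pair.
by apply/rowP => i; rewrite mxE rV_consS.
Qed.

Lemma rV_unconsK : cancel rV_uncons rV_cons.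
Proof.
move=> x; apply/rowP => i; case: (unliftP ord0 i) => [j|] ->.
  by rewrite rV_consS mxE.
by rewrite rV_cons0.
Qed.

Lemma measurable_rV_cons : measurable_fun setT rV_cons.
Proof.
apply: measurable_fun_rVP => i; case: (unliftP ord0 i) => [j|] ->.
  under eq_fun do rewrite /rV_coord rV_consS.
  exact: (measurableT_comp (measurable_rV_coord j) measurable_snd).
under eq_fun do rewrite /rV_coord rV_cons0.
exact: measurable_fst.
Qed.

Lemma measurable_rV_uncons : measurable_fun setT rV_uncons.
Proof.
apply/measurable_fun_pairP; split; first exact: (measurable_rV_coord ord0).
apply: measurable_fun_rVP => i.
under eq_fun do rewrite /rV_coord mxE.
exact: (measurable_rV_coord (lift ord0 i)).
Qed.

Definition lebesgue_rV_step : set 'rV[R]_d.+1 -> \bar R :=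
  pushforward (lebesgue_measure \x m)%E rV_cons.

Let mprod : {measure set (measurableTypeR R * 'rV[R]_d)%type -> \bar R} :=
  (lebesgue_measure \x m)%E.

Let step0 : lebesgue_rV_step set0 = 0%E.
Proof. by rewrite /lebesgue_rV_step /pushforward preimage_set0 measure0. Qed.

Let step_ge0 A : (0 <= lebesgue_rV_step A)%E.
Proof. exact: (measure_ge0 mprod). Qed.

Let measurable_cons_preimage A :
  measurable A -> measurable (rV_cons @^-1` A).
Proof.
by move=> mA; rewrite -[X in measurable X]setTI; exact: measurable_rV_cons.
Qed.

Let step_sigma_additive : semi_sigma_additive lebesgue_rV_step.
Proof.
move=> F mF tF mUF; rewrite /lebesgue_rV_step /pushforward preimage_bigcup.
apply: (@measure_semi_sigma_additive _ _ _ mprod).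
- by move=> n; exact: measurable_cons_preimage.
- apply/trivIsetP => /= i j _ _ ij; rewrite -preimage_setI.
  by move/trivIsetP : tF => /(_ _ _ _ _ ij) ->//; rewrite preimage_set0.
- by rewrite -preimage_bigcup; exact: measurable_cons_preimage.
Qed.

HB.instance Definition _ := isMeasure.Build _ _ _ lebesgue_rV_step
  step0 step_ge0 step_sigma_additive.

Let step_sigma_finite : sigma_finite setT lebesgue_rV_step.
Proof.
have /sigma_finiteP[F [FT ndF Foo]] := sigma_finiteT (@lebesgue_measure R).
have /sigma_finiteP[G [GT ndG Goo]] := sigma_finiteT m.
exists (fun n => rV_uncons @^-1` (F n `*` G n)).
  rewrite -preimage_bigcup (_ : \bigcup_n _ = setT) ?preimage_setT//.
  rewrite -setXTT FT GT predeqE => -[x y]; split.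
    by move=> [n _ []/= ? ?]; split; exists n.
  move=> [/= [n _ Fnx] [k _ Gky]]; exists (maxn n k) => //; split.
  - by move: x Fnx; exact/subsetPset/ndF/leq_maxl.
  - by move: y Gky; exact/subsetPset/ndG/leq_maxr.
move=> n; have [mF Fn] := Foo n; have [mG Gn] := Goo n; split.
  rewrite -[X in measurable X]setTI.
  by apply: measurable_rV_uncons => //; exact: measurableX.
rewrite /lebesgue_rV_step /pushforward -comp_preimage.
rewrite (_ : rV_uncons \o rV_cons = id) ?preimage_id; last first.
  by apply/funext => p; exact: rV_consK.
by rewrite product_measure1E// lte_mul_pinfty// ge0_fin_numE.
Qed.

HB.instance Definition _ := Measure_isSigmaFinite.Build _ _ _
  lebesgue_rV_step step_sigma_finite.

End lebesgue_rV_step.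

(* Lebesgue measure on R^d, by iterating the product with the Lebesgue measure
   of the line; on R^0 it is the Dirac mass at the only point. *)
Fixpoint lebesgue_rV (R : realType) (d : nat) :
    {sigma_finite_measure set 'rV[R]_d -> \bar R} :=
  match d with
  | 0%N => \d_(0 : 'rV[R]_0)
  | d'.+1 => lebesgue_rV_step (lebesgue_rV R d')
  end.

Lemma measurable_rV_box (R : realType) (d : nat) (A : 'I_d -> set R) :
  (forall i, measurable (A i)) ->
  measurable [set x : 'rV[R]_d | forall i, A i (x ord0 i)].
Proof.
move=> mA.
rewrite (_ : [set _ | _] =
    \bigcap_(i in [set: 'I_d]) (@rV_coord R d i @^-1` A i)); last first.
  by apply/seteqP; split => [x Ax i _|x Ax i]; [exact: Ax|exact: (Ax i)].
apply: fin_bigcap_measurable => // i _.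
by rewrite -[X in measurable X]setTI; exact: measurable_rV_coord.
Qed.

Lemma lebesgue_rV_box (R : realType) (d : nat) (A : 'I_d -> set R) :
  (forall i, measurable (A i)) ->
  lebesgue_rV R d [set x | forall i, A i (x ord0 i)] =
  (\prod_(i < d) lebesgue_measure (A i))%E.
Proof.
elim: d A => [|d IH] A mA.
  by rewrite big_ord0 /= diracE mem_set// => -[].
rewrite big_ord_recl -IH//= /lebesgue_rV_step /pushforward.
pose B := [set x : 'rV[R]_d | forall i, A (lift ord0 i) (x ord0 i)].
rewrite (_ : _ @^-1` _ = A ord0 `*` B); last first.
  apply/seteqP; split => [p /= Ap|p /= [A0 AS] i].
    split; first by have := Ap ord0; rewrite rV_cons0.
    by move=> i; have := Ap (lift ord0 i); rewrite rV_consS.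
  by case: (unliftP ord0 i) => [j|] ->; rewrite ?rV_cons0// rV_consS.
have mB : measurable B.
  exact: (@measurable_rV_box R d (fun i => A (lift ord0 i))).
exact: (@product_measure1E _ _ (measurableTypeR R) _ R lebesgue_measure
  (lebesgue_rV R d) (A ord0) B (mA ord0) mB).
Qed.

Section boolean_model.
Context (R : realType) (d : nat).

Definition enorm (x : 'rV[R]_d) : R :=
  Num.sqrt (\sum_(i < d) x ord0 i ^+ 2).

Definition cball (x : 'rV[R]_d) (r : R) : set 'rV[R]_d :=
  [set y | enorm (y - x) <= r].

Definition sphere (x : 'rV[R]_d) (r : R) : set 'rV[R]_d :=
  [set y | enorm (y - x) = r].

Definition occupied (eta : set ('rV[R]_d * R)) : set 'rV[R]_d :=
  \bigcup_(p in eta) cball p.1 p.2.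

(* The topology of 'rV[R]_d is the product topology of R^d. *)
Definition path_connected_in (O : set 'rV[R]_d) (x y : 'rV[R]_d) : Prop :=
  exists gamma : R -> 'rV[R]_d,
    [/\ {within `[0, 1], continuous gamma}, gamma 0 = x, gamma 1 = y
      & gamma @` `[0, 1] `<=` O].

Definition point_count (B : set ('rV[R]_d * R)) (eta : set ('rV[R]_d * R)) :
  \bar R := counting (eta `&` B).

(* A configuration is a set of marked points, and the space of configurations
   carries the sigma-algebra generated by the counts of the measurable sets.
   Sets without multiplicities suffice because the intensities considered
   below do not charge {z} x R, so that the process is almost surely simple. *)
Definition count_events : set (set (set ('rV[R]_d * R))) :=
  \bigcup_(B in measurable) preimage_set_system setT (point_count B) measurable.

Definition configuration := g_sigma_algebraType count_events.

(* poisson_prob, unlike poisson_pmf, is the Dirac mass at 0 for the rate 0;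
   its natural number argument is ignored. *)
Record is_poisson_process (L : set ('rV[R]_d * R) -> \bar R)
    (P : probability configuration R) : Prop := {
  poisson_count : forall B (k : nat), measurable B -> (L B < +oo)%E ->
    P [set eta | point_count B eta = k%:R%:E] =
    poisson_prob (fine (L B)) 0%N [set k] ;
  poisson_count_infinite : forall B, measurable B -> L B = +oo%E ->
    P [set eta | point_count B eta = +oo%E] = 1%E ;
  poisson_independence :
    forall (n : nat) (B : 'I_n -> set ('rV[R]_d * R))
           (U : 'I_n -> set (\bar R)),
    (forall i, measurable (B i)) -> trivIset setT B ->
    (forall i, measurable (U i)) ->
    P (\bigcap_(i in [set: 'I_n]) [set eta | U i (point_count (B i) eta)]) =
    (\prod_(i < n) P [set eta | U i (point_count (B i) eta)])%E }.

(* Radius laws are finite measures on R that vanish on ]-oo, 0[; balls of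
   negative radius are empty. *)
Definition boolean_intensity (mu : {finite_measure set R -> \bar R}) (l : R) :
    set ('rV[R]_d * R) -> \bar R :=
  fun B => (l%:E * (lebesgue_rV R d \x mu) B)%E.

Definition connection (X Y : set 'rV[R]_d) : set configuration :=
  [set eta | exists x y,
     [/\ X x, Y y & path_connected_in (occupied eta) x y]].

(* The events of connection are measurable only up to null sets, because of
   the configurations that are not locally finite: the outer measure of P
   extends P to its completion, whereas P itself is unspecified outside of
   the sigma-algebra. *)
Definition Pr (P : probability configuration R) (A : set configuration) :
  \bar R := mu_ext P A.

Definition theta (P : R -> probability configuration R) (r l : R) : \bar R :=
  Pr (P l) (connection [set 0] (sphere 0 r)).

(* An extended real number: the infimum of the empty set is +oo. *)
Definition lambda_c_tilde (P : R -> probability configuration R) : \bar R :=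
  ereal_inf [set l%:E | l in [set l : R | 0 <= l /\
    (0 < ereal_inf [set Pr (P l) (connection (cball 0 r) (sphere 0 (2 * r)))
                    | r in [set r : R | (0 < r)%R]])%E]].

End boolean_model.

(* Main.v *)
(* Below [lambda_c_tilde] some crossing probability P[B_L <-> dB_2L] is as small
   as we please, and L is then large, because at bounded scales a chain of balls
   along a segment gives a positive lower bound. Cut space into cells of side
   s = L / d. Every point of a long path from 0 has in its neighbourhood either
   a local crossing at scale L by balls of radius < s, or a ball of radius >= s
   whose size pays for its distance. These bad objects form a chain from 0 to the
   sphere. The local crossings are dominated by events that depend on finitely
   many counts, so bad objects in distinct cells of a common residue class are
   independent, and a union bound over the chains, weighted exponentially in the
   distance they cover, gives the exponential decay. *)

Require Import Defs.
From mathcomp Require Import all_boot all_order all_algebra.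
From mathcomp Require Import all_classical all_reals all_analysis.
From mathcomp Require Import measurable_realfun.
From mathcomp Require Import ring lra zify.
Import Order.TTheory GRing.Theory Num.Theory.
Import numFieldNormedType.Exports.

Set Implicit Arguments.
Unset Strict Implicit.
Unset Printing Implicit Defensive.

Local Open Scope classical_set_scope.
Local Open Scope ring_scope.

(** * The Euclidean norm and paths *)

Section enorm.
Context {R : realType} {d : nat}.
Implicit Types (x y z : 'rV[R]_d) (r : R).

(** The obstacle is that connection events are only measurable up to null sets, so that their outer
    probabilities carry no independence. A local crossing is therefore replaced by the set of all
    configurations that occupy the same fine boxes as some configuration with a crossing. Such a set
    is a finite union of cylinders, whatever event it comes from, and for a suitable mesh its
    probability is below any given number exceeding the crossing probability. Combining the
    [K = (8 * d).+1 ^ d] residue classes takes a [K]-th root, so a single object must have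
    probability at most the [K]-th power of its weight. This fixes the order of the choices: [d]
    determines [C], [K] and the weights; the tail of [mu] then gives a scale [s0] beyond which every
    big ball is light enough; next comes [L], with a small crossing probability and hence with
    [L / d] beyond [s0]; the mesh is chosen last. *)

Lemma cauchy_schwarz_sum (a b : 'I_d -> R) :
  (\sum_i a i * b i) ^+ 2 <= (\sum_i a i ^+ 2) * (\sum_i b i ^+ 2).
Proof.
rewrite -subr_ge0 -(pmulr_rge0 _ (ltr0n R 2)).
(* Lagrange's identity: twice the defect in the inequality is a sum of squares. *)
have -> : 2%:R * ((\sum_i a i ^+ 2) * (\sum_i b i ^+ 2) - (\sum_i a i * b i) ^+ 2)
    = \sum_i \sum_j (a i * b j - a j * b i) ^+ 2.
  have E (f g : 'I_d -> R) : \sum_i \sum_j f i * g j = (\sum_i f i) * \sum_i g i.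
    by rewrite big_distrlr.
  transitivity (\sum_i \sum_j (a i ^+ 2 * b j ^+ 2 + b i ^+ 2 * a j ^+ 2
      - (2 * (a i * b i)) * (a j * b j))); last first.
    by apply: eq_bigr => i _; apply: eq_bigr => j _; ring.
  symmetry; under eq_bigr => i _ do rewrite sumrB big_split /=.
  rewrite sumrB big_split /= !E -mulr_sumr.
  by ring.
by apply: sumr_ge0 => i _; apply: sumr_ge0 => j _; exact: sqr_ge0.
Qed.

Lemma enorm_ge0 x : 0 <= enorm x.
Proof. exact: sqrtr_ge0. Qed.

Lemma sqr_enorm x : enorm x ^+ 2 = \sum_i x ord0 i ^+ 2.
Proof. by rewrite sqr_sqrtr//; apply: sumr_ge0 => i _; exact: sqr_ge0. Qed.

Lemma enormD x y : enorm (x + y) <= enorm x + enorm y.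
Proof.
rewrite -(ler_pXn2r (ltn0Sn 1)) ?nnegrE ?addr_ge0 ?enorm_ge0//.
rewrite sqrrD !sqr_enorm.
under eq_bigr => i _ do rewrite mxE sqrrD.
rewrite 2!big_split /= lerD2r lerD2l -mulr_natl.
under eq_bigr => i _ do rewrite -mulr_natl.
rewrite -mulr_sumr ler_pM2l ?ltr0n//.
apply: le_trans (ler_norm _) _.
rewrite -(ler_pXn2r (ltn0Sn 1)) ?nnegrE ?mulr_ge0 ?enorm_ge0//.
by rewrite real_normK ?num_real// exprMn !sqr_enorm cauchy_schwarz_sum.
Qed.

Lemma enorm0 : enorm (0 : 'rV[R]_d) = 0.
Proof.
by rewrite /enorm big1 ?sqrtr0// => i _; rewrite mxE expr0n.
Qed.

Lemma enormZ r x : enorm (r *: x) = `|r| * enorm x.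
Proof.
rewrite /enorm; under eq_bigr => i _ do rewrite mxE exprMn.
by rewrite -mulr_sumr sqrtrM ?sqr_ge0// sqrtr_sqr.
Qed.

Lemma enormN x : enorm (- x) = enorm x.
Proof. by rewrite -scaleN1r enormZ normrN1 mul1r. Qed.

Lemma enormBC x y : enorm (x - y) = enorm (y - x).
Proof. by rewrite -enormN opprB. Qed.

Lemma enorm_triangle z x y : enorm (x - y) <= enorm (x - z) + enorm (z - y).
Proof. by apply: le_trans (enormD _ _); rewrite addrA subrK. Qed.

Lemma normr_le_enorm x i : `|x ord0 i| <= enorm x.
Proof.
rewrite -sqrtr_sqr ler_wsqrtr// (bigD1 i)//= lerDl.
by apply: sumr_ge0 => j _; exact: sqr_ge0.
Qed.

Lemma enorm_le_coord x r : (0 <= r) -> (forall i, `|x ord0 i| <= r) ->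
  enorm x <= d%:R * r.
Proof.
move=> r0 xr.
apply: (@le_trans _ _ (\sum_i `|x ord0 i|)); last first.
  apply: le_trans (ler_sum _ (fun i _ => xr i)) _.
  by rewrite sumr_const card_ord mulr_natl.
have s0 : 0 <= \sum_i `|x ord0 i| by apply: sumr_ge0.
rewrite -(ler_pXn2r (ltn0Sn 1)) ?nnegrE ?enorm_ge0// sqr_enorm.
rewrite [leRHS]expr2 mulr_suml; apply: ler_sum => i _.
rewrite -real_normK ?num_real// expr2 ler_wpM2l// (bigD1 i)//= lerDl.
by apply: sumr_ge0.
Qed.

Lemma enorm_le_mx_norm x : enorm x <= d%:R * `|x|.
Proof.
apply: enorm_le_coord => // i.
by rewrite [leRHS]/Num.norm /= mx_normrE; exact: (le_bigmax _ (fun ij => `|x ij.1 ij.2|) (ord0, i)).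
Qed.

Lemma ler_dist_enorm x y : `|enorm x - enorm y| <= enorm (x - y).
Proof.
rewrite ler_norml; apply/andP; split.
  have := enorm_triangle x y 0; rewrite !subr0 (enormBC y x); lra.
have := enorm_triangle y x 0; rewrite !subr0; lra.
Qed.

Lemma enorm_delta (i : 'I_d) : enorm (delta_mx ord0 i : 'rV[R]_d) = 1.
Proof.
rewrite /enorm (bigD1 i)//= big1 ?mxE ?eqxx ?expr1n ?addr0 ?sqrtr1//.
by move=> j /negPf iE; rewrite mxE eqxx iE expr0n.
Qed.

Lemma mx_norm_le_enorm x : `|x| <= enorm x.
Proof.
rewrite [leLHS]/Num.norm /= mx_normrE; apply/bigmax_leP; split; first exact: enorm_ge0.
by move=> -[i j] _ /=; rewrite ord1; exact: normr_le_enorm.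
Qed.

Lemma within_continuous_enormP (A : set R) (f : R -> 'rV[R]_d) :
  {within A, continuous f} <->
  forall s, A s -> forall e, 0 < e -> exists2 r, 0 < r &
    forall t, A t -> `|s - t| < r -> enorm (f s - f t) < e.
Proof.
have dp : (0 < d%:R + 1 :> R) by rewrite ltr_wpDl.
split=> [/subspace_continuousP h x Ax e e0|h].
  have /cvgrPdist_lt/(_ (e / (d%:R + 1))) := h x Ax.
  rewrite divr_gt0// => /(_ isT); rewrite /within/= => /nbhs_ballP[r r0 hr].
  exists r => // y Ay xy.
  apply: le_lt_trans (enorm_le_mx_norm _) _.
  apply: (@le_lt_trans _ _ ((d%:R + 1) * `|f x - f y|)).
    by rewrite ler_wpM2r// lerDl.
  by rewrite -ltr_pdivlMl// mulrC; apply: hr.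
apply/subspace_continuousP => x Ax; apply/cvgrPdist_lt => e e0.
have [r r0 hr] := h x Ax e e0.
apply/nbhs_ballP; exists r => // y xy Ay.
by apply: le_lt_trans (mx_norm_le_enorm _) _; apply: hr.
Qed.

Lemma within_continuous_enorm (A : set R) (f : R -> 'rV[R]_d) :
  {within A, continuous f} -> {within A, continuous (fun t => enorm (f t))}.
Proof.
move=> /within_continuous_enormP h; apply/subspace_continuousP => x Ax.
apply/cvgrPdist_lt => e e0; have [r r0 hr] := h x Ax e e0.
apply/nbhs_ballP; exists r => // y xy Ay.
by apply: le_lt_trans (ler_dist_enorm _ _) _; apply: hr.
Qed.

End enorm.

Section paths.
Context {R : realType} {d : nat}.
Implicit Types (x y z : 'rV[R]_d) (O : set 'rV[R]_d).

Definition eclose (e : R) : rel 'rV[R]_d := fun x y => enorm (x - y) <= e.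

(** Continuous induction: at the supremum of the times whose point ends an [e]-chain, continuity
    with error [e / 2] on either side extends the chain to all nearby times, so that time 1 is
    reached. *)
Lemma path_connected_in_sample O x y (e : R) : 0 < e ->
  path_connected_in O x y ->
  exists p, [/\ path (eclose e) x p, last x p = y & forall z, z \in x :: p -> O z].
Proof.
move=> e0 [g [/within_continuous_enormP gc g0 g1 gO]].
pose chain t := exists p, [/\ path (eclose e) x p, last x p = g t
  & forall z, z \in x :: p -> O z].
suff : chain 1 by rewrite /chain g1.
pose S := [set t : R | 0 <= t <= 1 /\ chain t].
have S0 : S 0.
  split; first by rewrite lexx ler01.
  exists [::]; split=> // z; rewrite inE => /eqP ->; rewrite -g0; apply: gO.
  by exists 0 => //=; rewrite in_itv/= lexx ler01.
have supS : has_sup S by split; [exists 0|exists 1 => t [/andP[]]].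
have s01 : 0 <= sup S <= 1.
  apply/andP; split; first exact: sup_upper_bound.
  by apply: ge_sup; [exists 0|move=> t [/andP[]]].
have e2 : 0 < e / 2 by rewrite divr_gt0.
have [|r r0 hr] := gc (sup S) _ _ e2; first by rewrite /= in_itv.
have [t1 [t101 [p [pp lp Op]]] t1S] := sup_adherent r0 supS.
have near t : 0 <= t <= 1 -> `|sup S - t| < r -> chain t.
  move=> t01 tr; exists (rcons p (g t)); split; last 2 first.
  - by rewrite last_rcons.
  - move=> z; rewrite -rcons_cons mem_rcons inE => /orP[/eqP ->|]; last exact: Op.
    by apply: gO; exists t => //=; rewrite in_itv.
  rewrite rcons_path pp lp /= /eclose.
  have t1le : t1 <= sup S by apply: sup_upper_bound => //; split => //; exists p.
  have := enorm_triangle (g (sup S)) (g t1) (g t).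
  have h1 : enorm (g (sup S) - g t1) < e / 2.
    by apply: hr; rewrite /= ?in_itv//= ger0_norm ?subr_ge0//; lra.
  have h2 : enorm (g (sup S) - g t) < e / 2 by apply: hr; rewrite /= ?in_itv.
  rewrite (enormBC (g t1) (g (sup S))); lra.
have [S1|S1] := ltP (sup S + r / 2) 1; last first.
  apply: near; first by rewrite ler01 lexx.
  by case/andP: s01 => s0 s1; rewrite distrC ger0_norm ?subr_ge0//; lra.
case/andP: s01 => s0 s1.
have : sup S + r / 2 <= sup S.
  apply: sup_upper_bound => //; split; first lra.
  apply: near; first by apply/andP; split; lra.
  by rewrite opprD addrA subrr sub0r normrN ger0_norm; lra.
lra.
Qed.

Lemma path_connected_in_trans O y x z :
  path_connected_in O x y -> path_connected_in O y z -> path_connected_in O x z.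
Proof.
move=> [f [/within_continuous_enormP fc f0 f1 fO]].
move=> [g [/within_continuous_enormP gc g0 g1 gO]].
have h2 : 0 < 2 :> R by [].
pose h t := if t <= 2^-1 then f (2 * t) else g (2 * t - 1).
have h12 : h 2^-1 = y by rewrite /h lexx divff ?pnatr_eq0.
have hl t : t <= 2^-1 -> h t = f (2 * t) by rewrite /h => ->.
have hr t : 2^-1 <= t -> h t = g (2 * t - 1).
  rewrite le_eqVlt => /orP[/eqP <-|tl]; first by rewrite h12 divff ?pnatr_eq0// subrr.
  by rewrite /h leNgt tl.
exists h; split.
- apply/within_continuous_enormP => s; rewrite /= in_itv/= => s01 e e0.
  have fs u : 0 <= u <= 2^-1 -> exists2 r : R, 0 < r & forall t, 0 <= t <= 2^-1 ->
      `|u - t| < r -> enorm (h u - h t) < e.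
    move=> u0; have [|r r0 H] := fc (2 * u) _ e e0; first by rewrite /= in_itv/=; lra.
    exists (r / 2); first by rewrite divr_gt0.
    move=> t t0 ut; rewrite !hl ; try lra.
    apply: H; first by rewrite /= in_itv/=; lra.
    by rewrite -mulrBr normrM ger0_norm// -ltr_pdivlMl// mulrC.
  have gs u : 2^-1 <= u <= 1 -> exists2 r : R, 0 < r & forall t, 2^-1 <= t <= 1 ->
      `|u - t| < r -> enorm (h u - h t) < e.
    move=> u0; have [|r r0 H] := gc (2 * u - 1) _ e e0; first by rewrite /= in_itv/=; lra.
    exists (r / 2); first by rewrite divr_gt0.
    move=> t t0 ut; rewrite !hr ; try lra.
    apply: H; first by rewrite /= in_itv/=; lra.
    rewrite (_ : 2 * u - 1 - (2 * t - 1) = 2 * (u - t)); last by ring.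
    by rewrite normrM ger0_norm// -ltr_pdivlMl// mulrC.
  have [sl|sl|sE] := ltrgtP s 2^-1.
  + have [|r r0 H] := fs s; first lra.
    exists (Num.min r (2^-1 - s)); first by rewrite lt_min r0 subr_gt0.
    move=> t; rewrite /= in_itv/= lt_min => t01 /andP[tr]; rewrite ltr_norml => /andP[? _].
    by apply: H => //; lra.
  + have [|r r0 H] := gs s; first lra.
    exists (Num.min r (s - 2^-1)); first by rewrite lt_min r0 subr_gt0.
    move=> t; rewrite /= in_itv/= lt_min => t01 /andP[tr]; rewrite ltr_norml => /andP[_ ?].
    by apply: H => //; lra.
  + have [|r r0 H] := fs s; first lra.
    have [|r' r'0 H'] := gs s; first lra.
    exists (Num.min r r'); first by rewrite lt_min r0.
    move=> t; rewrite /= in_itv/= lt_min => t01 /andP[tr tr'].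
    by have [tl|tl] := leP t 2^-1; [apply: H => //; lra|apply: H' => //; lra].
- by rewrite hl ?invr_ge0// mulr0.
- rewrite hr; last by rewrite invf_le1// ler1n.
  by rewrite mulr1 (_ : 2 - 1 = 1)//; ring.
- move=> ? [t /=]; rewrite in_itv/= => t01 <-.
  have [tl|tl] := leP t 2^-1.
    by rewrite hl//; apply: fO; exists (2 * t) => //; rewrite /= in_itv/=; lra.
  by rewrite hr; [apply: gO; exists (2 * t - 1) => //; rewrite /= in_itv/=; lra|lra].
Qed.

Lemma segment_path_connected_in O x y :
  (forall t : R, 0 <= t <= 1 -> O (x + t *: (y - x))) -> path_connected_in O x y.
Proof.
move=> h; exists (fun t => x + t *: (y - x)); split.
- apply/within_continuous_enormP => s _ e e0.
  have k0 : 0 < enorm (y - x) + 1 by rewrite ltr_wpDl ?enorm_ge0.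
  exists (e / (enorm (y - x) + 1)); first by rewrite divr_gt0.
  move=> t _; rewrite ltr_pdivlMr// => st.
  rewrite opprD addrACA subrr add0r -scalerBl enormZ.
  apply: le_lt_trans st; rewrite ler_wpM2l// lerDl ler01//.
- by rewrite scale0r addr0.
- by rewrite scale1r addrC subrK.
- by move=> ? [t /=]; rewrite in_itv/= => t01 <-; exact: h.
Qed.

Lemma cball_path_connected_in O c r x y : cball c r `<=` O ->
  cball c r x -> cball c r y -> path_connected_in O x y.
Proof.
move=> cO cx cy; apply: segment_path_connected_in => t /andP[t0 t1].
apply: cO; rewrite /cball/=.
rewrite (_ : _ - c = (1 - t) *: (x - c) + t *: (y - c)); last first.
  by apply/rowP => i; rewrite !mxE; ring.
apply: le_trans (enormD _ _) _; rewrite !enormZ !ger0_norm ?subr_ge0//.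
rewrite /cball/= in cx cy.
have : t * enorm (y - c) <= t * r by rewrite ler_wpM2l.
have : (1 - t) * enorm (x - c) <= (1 - t) * r by rewrite ler_wpM2l ?subr_ge0.
lra.
Qed.

(** By the intermediate value theorem. A path that gets beyond the sphere is cut at a point of it,
    since [connection] asks for an end point exactly on [sphere]. *)
Lemma path_connected_in_sphere O x y (r : R) :
  path_connected_in O x y -> enorm x <= r -> r <= enorm y ->
  exists2 z, enorm z = r & path_connected_in O x z.
Proof.
move=> [g [gc g0 g1 gO]] xr ry.
have [||t t01 gt] := IVT (f := fun t => enorm (g t)) (v := r) (@ler01 R).
- exact: within_continuous_enorm.
- rewrite g0 g1; apply/andP; split; first by rewrite ge_min xr.
  by rewrite le_max ry orbT.
exists (g t) => //; move: t01; rewrite in_itv/= => /andP[t0 t1].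
exists (fun s => g (s * t)); split.
- apply/within_continuous_enormP => s; rewrite /= in_itv/= => /andP[s0 s1] e e0.
  have st : `[0, 1]%classic (s * t).
    by rewrite /= in_itv/= mulr_ge0//= mulr_ile1.
  have [q q0 H] := (within_continuous_enormP _ _).1 gc _ st _ e0.
  exists q => // u; rewrite /= in_itv/= => /andP[u0 u1] su; apply: H.
    by rewrite /= in_itv/= mulr_ge0//= mulr_ile1.
  rewrite -mulrBl normrM (ger0_norm t0); apply: le_lt_trans su.
  by rewrite ler_piMr.
- by rewrite mul0r.
- by rewrite mul1r.
- move=> ? [s /=]; rewrite in_itv/= => /andP[s0 s1] <-; apply: gO.
  by exists (s * t) => //; rewrite /= in_itv/= mulr_ge0//= mulr_ile1.
Qed.

End paths.

(** * Occupation patterns of the Poisson process *)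

Section hits.
Context {R : realType} {d : nat}.
Implicit Types (B : set ('rV[R]_d * R)).

Definition hit B : set (configuration R d) := [set eta | eta `&` B !=set0].

Definition hitb (b : bool) B : set (configuration R d) :=
  if b then hit B else ~` hit B.

Lemma point_count_eq0 B (eta : configuration R d) :
  point_count B eta = 0%E <-> ~ hit B eta.
Proof.
rewrite /point_count /counting /hit/=; split.
  case: ifPn => // /asboolP fB [] /eqP.
  rewrite pnatr_eq0 mathcomp.finmap.finmap.cardfs_eq0 => /eqP.
  by move=> /(fset_set_set0 fB) -> [].
move=> /set0P/negP; rewrite negbK => /eqP ->.
by rewrite asboolT// fset_set0.
Qed.

Lemma hitb_count b B : hitb b B =
  [set eta | (if b then ~` [set 0%E] else [set 0%E]) (point_count B eta)].
Proof.
apply/seteqP; split => eta; rewrite /hitb; case: b => /=.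
- by move=> h /point_count_eq0; apply.
- by move=> h; apply/point_count_eq0.
- by move=> h; apply: contrapT => /point_count_eq0.
- by move=> /point_count_eq0.
Qed.

Lemma measurable_hitb b B : measurable B -> measurable (hitb b B).
Proof.
move=> mB; rewrite hitb_count; apply: sub_sigma_algebra.
exists B => //; exists (if b then ~` [set 0%E] else [set 0%E]).
  by case: b; [apply: measurableC|]; exact: emeasurable_set1.
by rewrite setTI.
Qed.

Lemma measurable_hit B : measurable B -> measurable (hit B).
Proof. exact: (@measurable_hitb true). Qed.

Section saturation.
Context {T : finType}.
Implicit Types (F : T -> set ('rV[R]_d * R)) (S : pred {ffun T -> bool}).

Definition hits F (eta : configuration R d) : {ffun T -> bool} :=
  [ffun t => `[< hit (F t) eta >]].

(** For finitely many measurable boxes this event is measurable whatever the set [S] of patterns,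
    even if [S] is described through paths. *)
Definition sat F S : set (configuration R d) := [set eta | S (hits F eta)].

Definition cyl F (s : {ffun T -> bool}) : set (configuration R d) :=
  \bigcap_(t in [set: T]) hitb (s t) (F t).

Lemma cylP F s eta : cyl F s eta <-> hits F eta = s.
Proof.
split=> [h|<- t _].
  apply/ffunP => t; rewrite ffunE; have := h t I; rewrite /hitb.
  by case: (s t) => /= ?; [rewrite asboolT|rewrite asboolF].
rewrite /hitb ffunE; case: asboolP => //.
Qed.

Lemma satE F S : sat F S = \bigcup_(s in [set: {ffun T -> bool}])
  (if S s then cyl F s else set0).
Proof.
apply/seteqP; split => [eta Seta|eta [s _]].
  by exists (hits F eta) => //; rewrite ifT//; apply/cylP.
by case: ifPn => // Ss /cylP E; rewrite /sat/= E.
Qed.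

Lemma measurable_cyl F s : (forall t, measurable (F t)) -> measurable (cyl F s).
Proof.
move=> mF; apply: fin_bigcap_measurable => // t _.
exact: measurable_hitb.
Qed.

Lemma measurable_sat F S : (forall t, measurable (F t)) -> measurable (sat F S).
Proof.
move=> mF; rewrite satE; apply: fin_bigcup_measurable => // s _.
by case: ifP => // _; exact: measurable_cyl.
Qed.

End saturation.

Section poisson.
Context {L : set ('rV[R]_d * R) -> \bar R} {P : probability (configuration R d) R}.
Hypothesis HP : is_poisson_process L P.

Lemma poisson_void B (x : R) : measurable B -> L B = x%:E -> 0 <= x ->
  P (hitb false B) = (expR (- x))%:E.
Proof.
move=> mB LB x0; rewrite hitb_count /=.
have := poisson_count HP 0 mB; rewrite LB ltry => /(_ isT) ->/=.
rewrite /poisson_prob; move: x0; rewrite le_eqVlt => /orP[/eqP <-|x0].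
  by rewrite ltxx oppr0 expR0 diracE mem_set.
rewrite x0 esum_set1 ?lee_fin ?poisson_pmf_ge0//.
by rewrite /poisson_pmf x0 expr0 fact0 invr1 !mul1r.
Qed.

Lemma poisson_hit B (x : R) : measurable B -> L B = x%:E -> 0 <= x ->
  P (hit B) = (1 - expR (- x))%:E.
Proof.
move=> mB LB x0; rewrite -[hit B]setCK probability_setC.
  by rewrite (poisson_void mB LB x0).
exact: (@measurable_hitb false).
Qed.

Lemma poisson_cyl {T : finType} (F : T -> set ('rV[R]_d * R)) s :
  (forall t, measurable (F t)) -> trivIset setT F ->
  P (cyl F s) = (\prod_t P (hitb (s t) (F t)))%E.
Proof.
move=> mF tF.
have := poisson_independence HP (B := fun i => F (enum_val i))
  (U := fun i : 'I_#|T| => if s (enum_val i) then ~` [set 0%E] else [set 0%E]).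
move=> /(_ (fun i => mF _)).
have tF' : trivIset setT (fun i : 'I_#|T| => F (enum_val i)).
  move=> i j _ _ /(tF _ _ I I); exact: enum_val_inj.
move=> /(_ tF').
have mU (i : 'I_#|T|) : measurable (if s (enum_val i) then ~` [set 0%E] else [set 0%E] : set (\bar R)).
  by case: ifP => _; [apply: measurableC|]; exact: emeasurable_set1.
move=> /(_ mU) E.
transitivity (P (\bigcap_(i in [set: 'I_#|T|]) hitb (s (enum_val i)) (F (enum_val i)))).
  congr (P _); apply/seteqP; split => eta h t _; first exact: h.
  by have := h (enum_rank t) I; rewrite enum_rankK.
under eq_bigcapr => i _ do rewrite hitb_count.
rewrite E [RHS](reindex (@enum_val T predT)); last first.
  by apply: onW_bij; exact: enum_val_bij.
by apply: eq_bigr => i _; rewrite hitb_count.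
Qed.

Lemma fine_poisson_sat {T : finType} (F : T -> set ('rV[R]_d * R)) S :
  (forall t, measurable (F t)) -> trivIset setT F ->
  fine (P (sat F S)) = \sum_(s | S s) \prod_t fine (P (hitb (s t) (F t))).
Proof.
move=> mF tF; rewrite satE measure_fin_bigcup//; last 2 first.
- move=> s s' _ _; case: ifP => _; case: ifP => _; rewrite ?set0I ?setI0;
    try by case.
  by move=> [eta [/cylP <- /cylP <-]].
- by move=> s _; case: ifP => // _; exact: measurable_cyl.
rewrite (fsbigE (index_enum _)) ?index_enum_uniq//; last first.
  by move=> i _; rewrite mem_index_enum.
rewrite (eq_bigl predT); last by move=> s; rewrite in_setT.
rewrite [RHS]big_mkcond/= -sum_fine; last first.
  by move=> s _; apply: fin_num_measure; case: ifP => // _; exact: measurable_cyl.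
apply: eq_bigr => s _; case: ifP => _; last by rewrite measure0.
rewrite poisson_cyl//.
rewrite (eq_bigr (fun t => (fine (P (hitb (s t) (F t))))%:E)); last first.
  by move=> t _; rewrite fineK// fin_num_measure//; exact: measurable_hitb.
- by rewrite prodEFin.
- exact: finite_finset.
Qed.

(** Distributing the product over the sums given by [fine_poisson_sat] produces a sum over families
    of patterns, which are the joint patterns on [J * T]; these factor because all the boxes are
    disjoint. *)
Lemma fine_poisson_sat_indep {J T : finType} (F : J -> T -> set ('rV[R]_d * R))
    (S : J -> pred {ffun T -> bool}) :
  (forall i t, measurable (F i t)) ->
  trivIset setT (fun it : J * T => F it.1 it.2) ->
  fine (P (\bigcap_(i in [set: J]) sat (F i) (S i))) =
  \prod_i fine (P (sat (F i) (S i))).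
Proof.
move=> mF tF.
have tFi i : trivIset setT (F i).
  by move=> t t' _ _ h; have /(_ I I h)[] := tF (i, t) (i, t').
under [RHS]eq_bigr => i _ do rewrite fine_poisson_sat// big_mkcond.
rewrite bigA_distr_bigA/=.
pose G it := F it.1 it.2.
pose S' (s : {ffun J * T -> bool}) := [forall i, S i [ffun t => s (i, t)]].
transitivity (fine (P (sat G S'))).
  congr (fine (P _)); apply/seteqP; split => eta h.
    apply/forallP => i; have := h i I; rewrite /sat/=; congr (S i _).
    by apply/ffunP => t; rewrite !ffunE.
  move=> i _; move/forallP : h => /(_ i); rewrite /sat/=; congr (S i _).
  by apply/ffunP => t; rewrite !ffunE.
rewrite fine_poisson_sat//; last by move=> -[].
pose f (s : {ffun J -> {ffun T -> bool}}) : {ffun J * T -> bool} :=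
  [ffun it => s it.1 it.2].
pose g (s : {ffun J * T -> bool}) : {ffun J -> {ffun T -> bool}} :=
  [ffun i => [ffun t => s (i, t)]].
rewrite (reindex f); last first.
  exists g => s _; first by apply/ffunP => i; apply/ffunP => t; rewrite !ffunE.
  by apply/ffunP => -[i t]; rewrite !ffunE.
rewrite big_mkcond/=; apply: eq_bigr => s _.
have E i : [ffun t => f s (i, t)] = s i by apply/ffunP => t; rewrite !ffunE.
case: ifPn => [/forallP Ss|/forallPn[i Ss]].
  rewrite (eq_bigr (fun i => \prod_t fine (P (hitb (s i t) (F i t))))); last first.
    by move=> i _; rewrite -(E i) Ss.
  by rewrite pair_bigA/=; apply: eq_bigr => -[i t] _; rewrite !ffunE.
by rewrite (bigD1 i)//= -(E i) (negPf Ss) mul0r.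
Qed.

End poisson.
End hits.

(** * Cubic cells *)

Section cells.
Context {R : realType} {d : nat}.
Implicit Types (h : R).

Definition icell h (k : int) : set R := [set t | Num.floor (t / h) = k].

Definition gcell h (m : 'I_d -> int) : set 'rV[R]_d :=
  [set z | forall i, icell h (m i) (z ord0 i)].

Lemma icellP h k t : 0 < h -> icell h k t <-> k%:~R * h <= t < (k + 1)%:~R * h.
Proof.
move=> h0; rewrite /icell/= -ler_pdivlMr// -ltr_pdivrMr//; split=> [<-|tk].
  by rewrite floor_le_tmp floorD1_gt.
exact: floor_def.
Qed.

Lemma icellE h k : 0 < h -> icell h k = `[k%:~R * h, (k + 1)%:~R * h[%classic.
Proof.
by move=> h0; apply/seteqP; split => t; rewrite /= in_itv/= => /(icellP _ _ h0).
Qed.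

Lemma measurable_icell h k : 0 < h -> measurable (icell h k).
Proof. by move=> h0; rewrite icellE. Qed.

Lemma measurable_gcell h m : 0 < h -> measurable (gcell h m).
Proof.
move=> h0; apply: (@measurable_rV_box _ _ (fun i => icell h (m i))) => i.
exact: measurable_icell.
Qed.

Lemma lebesgue_gcell h m : 0 < h -> lebesgue_rV R d (gcell h m) = (h ^+ d)%:E.
Proof.
move=> h0; rewrite /gcell (@lebesgue_rV_box _ _ (fun i => icell h (m i))); last first.
  by move=> i; exact: measurable_icell.
under eq_bigr => i _ do rewrite icellE// lebesgue_measure_itv/= lte_fin
  ltr_pM2r// ltr_int ltzD1 lexx -EFinB -mulrBl -rmorphB/= addrAC subrr add0r mul1r.
by rewrite prodEFin prodr_const card_ord.
Qed.

Lemma intensity_box (mu : {finite_measure set R -> \bar R}) (l h : R) m I :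
  0 < h -> measurable I ->
  boolean_intensity mu l (gcell h m `*` I) = (l * (h ^+ d * fine (mu I)))%:E.
Proof.
move=> h0 mI; rewrite /boolean_intensity product_measure1E//; last first.
  exact: measurable_gcell.
rewrite [X in (_ * (X * _))%E](lebesgue_gcell m h0).
by rewrite EFinM EFinM fineK// fin_num_measure.
Qed.

(** The factor [d], rather than its square root, keeps the scale [L = d * s] an integral multiple of
    the cell side. *)
Lemma gcell_dist h m x y : 0 < h -> gcell h m x -> gcell h m y ->
  enorm (x - y) <= d%:R * h.
Proof.
move=> h0 mx my; apply: enorm_le_coord (ltW h0) _ => i.
have /(icellP _ _ h0) := mx i; have /(icellP _ _ h0) := my i.
rewrite !intrD !mxE mulrDl mul1r ler_norml => /andP[? ?] /andP[? ?].
by apply/andP; split; lra.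
Qed.

End cells.

(** * Local crossings *)

(** A substitute for a limit: applied to the gaps between finitely many balls, it turns contact up
    to a small error into contact. *)
Lemma finite_gap (R : realType) (U : set R) : finite_set U ->
  exists2 k, 0 < k & forall u, U u -> u <= k -> u <= 0.
Proof.
move=> /finite_seqP[s ->]; elim: s => [|a s [k k0 IH]].
  by exists 1 => // u /=; rewrite in_nil.
have [a0|a0] := ltP 0 a.
  exists (Num.min k (a / 2)); first by rewrite lt_min k0 divr_gt0.
  move=> u /=; rewrite inE le_min => /orP[/eqP ->|us] /andP[uk ua]; last exact: IH.
  lra.
by exists k => // u /=; rewrite inE => /orP[/eqP ->|us] // /IH; apply.
Qed.

Section local_crossing.
Context {R : realType} {d : nat}.
Implicit Types (eta : configuration R d) (x y z : 'rV[R]_d).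

Lemma touching_cballs x y (r r' : R) : 0 <= r -> 0 <= r' ->
  enorm (x - y) <= r + r' -> exists2 w, cball x r w & cball y r' w.
Proof.
move=> r0 r'0 xy; pose t := r / (r + r').
have [E|E] := eqVneq (r + r') 0.
  exists x; rewrite /cball/= ?subrr ?enorm0//; lra.
have rp : 0 < r + r' by rewrite lt_neqAle eq_sym E addr_ge0.
have t0 : 0 <= t by rewrite divr_ge0// ltW.
have t1 : t <= 1 by rewrite ler_pdivrMr// mul1r lerDl.
have tr : t * (r + r') = r by rewrite /t divfK.
exists (x + t *: (y - x)); rewrite /cball/=.
  rewrite addrAC subrr add0r enormZ ger0_norm// enormBC -[leRHS]tr.
  by rewrite ler_wpM2l.
rewrite (_ : _ - y = (1 - t) *: (x - y)); last by apply/rowP => i; rewrite !mxE; ring.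
rewrite enormZ ger0_norm ?subr_ge0//.
have : (1 - t) * enorm (x - y) <= (1 - t) * (r + r') by rewrite ler_wpM2l ?subr_ge0.
by rewrite (_ : (1 - t) * (r + r') = r')// mulrBl mul1r tr addrAC subrr add0r.
Qed.

Lemma cball_outward_point x (r : R) : (0 < d)%N -> 0 <= r ->
  exists2 w, cball x r w & enorm w = enorm x + r.
Proof.
move=> d0 r0; have [x0|x0] := eqVneq (enorm x) 0.
  pose e : 'rV[R]_d := delta_mx ord0 (Ordinal d0).
  have e1 : enorm e = 1 by exact: enorm_delta.
  have x00 : x = 0.
    apply/rowP => i; rewrite mxE; apply/eqP; rewrite -normr_le0 -x0.
    exact: normr_le_enorm.
  exists (r *: e); rewrite /cball/= x00 ?subr0 ?enorm0 ?add0r enormZ e1 mulr1 ger0_norm//.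
have xp : 0 < enorm x by rewrite lt_neqAle eq_sym x0 enorm_ge0.
exists (x + (r / enorm x) *: x); rewrite /cball/=.
  by rewrite addrAC subrr add0r enormZ ger0_norm ?divr_ge0 ?enorm_ge0// divfK.
rewrite -{1}[x]scale1r -scalerDl enormZ ger0_norm ?addr_ge0 ?divr_ge0 ?enorm_ge0//.
by rewrite mulrDl mul1r divfK.
Qed.

Variables (L s : R).

(** When [L = d * s] the half-width is [4 * L]. This leaves room for the centre of any ball of
    radius below [s] that meets the ball of radius [2 * L] around the corner of the cell [v],
    sampling errors included. *)
Definition window (v : 'I_d -> int) : set ('rV[R]_d * R) :=
  [set p : 'rV[R]_d * R | (forall i, (v i - (4 * d)%:Z)%:~R * s <= p.1 ord0 i < (v i + (4 * d)%:Z)%:~R * s)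
    /\ 0 <= p.2 < s].

(** The slack [k], in the steps and in the distance to a ball, lets the property survive, with a
    larger slack, the replacement of each ball by another one from the same fine box. *)
Definition crossing (k : R) eta := exists x xs,
  [/\ enorm x <= L, 2 * L <= enorm (last x xs), path (eclose k) x xs &
    forall z, z \in x :: xs ->
      exists q, [/\ eta q, window (fun=> 0) q & enorm (z - q.1) <= q.2 + k]].

Lemma crossing_connection eta : (0 < d)%N -> 0 <= L ->
  finite_set (eta `&` window (fun=> 0)) ->
  (forall k, 0 < k -> crossing k eta) ->
  connection (cball 0 L) (sphere 0 (2 * L)) eta.
Proof.
move=> d0 L0; set A := _ `&` _ => fA cr.
pose U := (fun pq : ('rV[R]_d * R) * ('rV[R]_d * R) =>
   enorm (pq.1.1 - pq.2.1) - pq.1.2 - pq.2.2) @` (A `*` A)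
  `|` ((fun p : 'rV[R]_d * R => enorm p.1 - p.2 - L) @` A
  `|` (fun p : 'rV[R]_d * R => 2 * L - enorm p.1 - p.2) @` A).
have fU : finite_set U.
  rewrite !finite_setU; do !split; apply: finite_image => //.
  exact: finite_setX.
have [k k0 gap] := finite_gap fU.
(* Between the balls of two consecutive points three errors add up: one for each ball and one for
   the step. *)
have k3 : 0 < k / 3 by rewrite divr_gt0.
have [x [xs [xL xsL pxs near]]] := cr _ k3.
have cO (q : 'rV[R]_d * R) : A q -> cball q.1 q.2 `<=` occupied eta.
  by move=> [eq _] y qy; exists q.
have r0 (q : 'rV[R]_d * R) : A q -> 0 <= q.2 by move=> [_ [_ /andP[]]].
have chain p : A p -> enorm (x - p.1) <= p.2 + k / 3 ->
    exists q, [/\ A q, enorm (last x xs - q.1) <= q.2 + k / 3 &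
      path_connected_in (occupied eta) p.1 q.1].
  move=> Ap xp; elim: xs x p pxs near Ap xp {xL xsL} => [|y ys IH] x p /= pxs near Ap xp.
    exists p; split=> //; apply: (cball_path_connected_in (cO _ Ap)).
      by rewrite /cball/= subrr enorm0 r0.
    by rewrite /cball/= subrr enorm0 r0.
  case/andP: pxs => xy pys.
  have [|q [eq Wq yq]] := near y; first by rewrite !inE eqxx orbT.
  have Aq : A q by split.
  have [|q' [Aq' lq' qq']] := IH y q pys _ Aq yq.
    by move=> z zy; apply: near; rewrite inE zy orbT.
  exists q'; split=> //; apply: path_connected_in_trans qq'.
  have : enorm (p.1 - q.1) - p.2 - q.2 <= 0.
    apply: gap; first by left; exists (p, q).
    have := enorm_triangle x p.1 q.1; have := enorm_triangle y x q.1.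
    rewrite (enormBC p.1 x); rewrite /eclose in xy; lra.
  move=> pq; have [|w pw qw] := @touching_cballs p.1 q.1 p.2 q.2 (r0 _ Ap) (r0 _ Aq).
    lra.
  apply: (@path_connected_in_trans _ _ _ w).
    apply: (cball_path_connected_in (cO _ Ap)) => //.
    by rewrite /cball/= subrr enorm0 r0.
  apply: (cball_path_connected_in (cO _ Aq)) => //.
  by rewrite /cball/= subrr enorm0 r0.
have [|p [ep Wp xp]] := near x; first by rewrite inE eqxx.
have Ap : A p by split.
have [q [Aq lq pq]] := chain p Ap xp.
have : enorm p.1 - p.2 - L <= 0.
  apply: gap; first by right; left; exists p.
  have := enorm_triangle x p.1 0; rewrite !subr0 (enormBC p.1 x); lra.
move=> pL; have [|w w0 pw] := @touching_cballs 0 p.1 L p.2 L0 (r0 _ Ap).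
  by rewrite enormBC subr0; lra.
have : 2 * L - enorm q.1 - q.2 <= 0.
  apply: gap; first by right; right; exists q.
  have := enorm_triangle q.1 (last x xs) 0; rewrite !subr0; lra.
(* The outermost point of the last ball lies on the sphere or beyond, so a path leading to it meets
   the sphere. *)
move=> qL; have [y qy yE] := cball_outward_point q.1 d0 (r0 _ Aq).
have wy : path_connected_in (occupied eta) w y.
  apply: (@path_connected_in_trans _ _ _ p.1).
    apply: (cball_path_connected_in (cO _ Ap)) => //.
    by rewrite /cball/= subrr enorm0 r0.
  apply: path_connected_in_trans pq _.
  apply: (cball_path_connected_in (cO _ Aq)) => //.
  by rewrite /cball/= subrr enorm0 r0.
rewrite /cball/= subr0 in w0.
have [||z zE wz] := path_connected_in_sphere wy (r := 2 * L); [lra|lra|].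
by exists w, z; split=> //; rewrite /cball/sphere/= subr0.
Qed.

End local_crossing.

(** * Discretised windows and patterns of local crossings *)

Section fine_boxes.
Context {R : realType} {d : nat}.
Variables (L s : R).
Hypothesis s0 : 0 < s.
Implicit Types (eta : configuration R d) (v : 'I_d -> int).

Definition mesh (n : nat) : R := s / n.+1%:R.

(** A window is [8 * d] cells wide and each cell is cut into [n.+1] slices in every direction; the
    radii below [s] are cut into [n.+1] slices as well. *)
Definition fine_index (n : nat) : finType :=
  ({ffun 'I_d -> 'I_(8 * d * n.+1)} * 'I_n.+1)%type.

Definition fbox n v (t : fine_index n) : set ('rV[R]_d * R) :=
  gcell (mesh n) (fun i => (v i - (4 * d)%:Z) * n.+1%:Z + (t.1 i : nat)%:Z)
  `*` icell (mesh n) (t.2 : nat)%:Z.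

Lemma mesh_gt0 n : 0 < mesh n.
Proof. by rewrite divr_gt0. Qed.

Lemma mulr_mesh n : n.+1%:R * mesh n = s.
Proof. by rewrite /mesh mulrC divfK. Qed.

Lemma fbox_window n v (t : fine_index n) : fbox v t `<=` window s v.
Proof.
have m0 := mesh_gt0 n; have E := mulr_mesh n.
have E' (k : int) : k%:~R * s = (k * n.+1%:Z)%:~R * mesh n.
  by rewrite intrM -mulrA -pmulrn E.
move=> p [pz pr]; split.
  move=> i; have /(icellP _ _ m0)/andP[h1 h2] := pz i; rewrite !E'.
  apply/andP; split.
    apply: le_trans h1; rewrite ler_pM2r// ler_int; lia.
  apply: lt_le_trans h2 _; rewrite ler_pM2r// ler_int.
  by have := ltn_ord (t.1 i); lia.
have /(icellP _ _ m0)/andP[h1 h2] := pr.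
apply/andP; split; first by apply: le_trans h1; rewrite mulr_ge0// ltW.
apply: lt_le_trans h2 _; rewrite -E ler_pM2r// pmulrn ler_int.
by have := ltn_ord t.2; lia.
Qed.

Lemma window_fbox n v p : window s v p -> exists t : fine_index n, fbox v t p.
Proof.
have m0 := mesh_gt0 n; have E := mulr_mesh n.
have E' (k : int) : k%:~R * s = (k * n.+1%:Z)%:~R * mesh n.
  by rewrite intrM -mulrA -pmulrn E.
move=> [pz /andP[pr1 pr2]].
have kz i : exists k : 'I_(8 * d * n.+1),
    Num.floor (p.1 ord0 i / mesh n) = (v i - (4 * d)%:Z) * n.+1%:Z + (k : nat)%:Z.
  have /andP[h1 h2] := pz i.
  have f1 : (v i - (4 * d)%:Z) * n.+1%:Z <= Num.floor (p.1 ord0 i / mesh n).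
    by rewrite floor_ge_int// ler_pdivlMr// -E'.
  have f2 : Num.floor (p.1 ord0 i / mesh n) < (v i + (4 * d)%:Z) * n.+1%:Z.
    by rewrite floor_lt_int// ltr_pdivrMr// -E'.
  set f := Num.floor _ in f1 f2 *.
  have kP : (`|(f - (v i - (4 * d)%:Z) * n.+1%:Z)%R|%N < 8 * d * n.+1)%N by lia.
  by exists (Ordinal kP); rewrite /=; lia.
have f1 : 0 <= Num.floor (p.2 / mesh n).
  by rewrite floor_ge_int// divr_ge0// ltW.
have f2 : Num.floor (p.2 / mesh n) < n.+1%:Z.
  by rewrite floor_lt_int// ltr_pdivrMr// -pmulrn E.
have kP : (`|Num.floor (p.2 / mesh n)| < n.+1)%N by lia.
have [f fE] := choice kz.
exists ([ffun i => f i], Ordinal kP); split => /=.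
  by move=> i; rewrite /icell/= ffunE fE.
by rewrite /icell/= gez0_abs.
Qed.

Lemma measurable_fbox n v t : measurable (@fbox n v t).
Proof.
by apply: measurableX; [exact: measurable_gcell (mesh_gt0 _)|exact: measurable_icell (mesh_gt0 _)].
Qed.

(* Agreement of the fine coordinates determines the index up to a multiple
   of the window, whence the congruence modulo [8 * d]. *)
Lemma fbox_inj n v v' (t t' : fine_index n) p :
  (forall i, (v i = v' i %[mod (8 * d)%N%:Z])%Z) ->
  fbox v t p -> fbox v' t' p -> v =1 v' /\ t = t'.
Proof.
move=> vv' [pz pr] [pz' pr'].
have Ei i : v i = v' i /\ t.1 i = t'.1 i.
  have := pz i; have := pz' i; rewrite /icell/= => ->.
  have := ltn_ord (t.1 i); have := ltn_ord (t'.1 i).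
  have /eqP := vv' i; rewrite eqz_mod_dvd => /dvdzP[q qE].
  move=> h1 h2 E.
  have qK : q * (8 * d * n.+1)%N%:Z = (t'.1 i : nat)%:Z - (t.1 i : nat)%:Z.
    have := congr1 (fun z => z * n.+1%:Z) qE; rewrite /= -mulrA -PoszM => <-.
    by move: E; lia.
  have q0 : q = 0.
    have aux (K a b : nat) (z : int) :
        (a < K)%N -> (b < K)%N -> z * K%:Z = b%:Z - a%:Z -> z = 0.
      by move=> aK bK zK; have [z1|z1|//] := ltrgtP z 0; nia.
    exact: aux h2 h1 qK.
  split; first by move: qE; rewrite q0 mul0r; lia.
  move: qK; rewrite q0 mul0r => qK.
  by apply: val_inj => /=; lia.
split; first by move=> i; have [] := Ei i.
rewrite [t]surjective_pairing [t']surjective_pairing; congr pair.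
  by apply/ffunP => i; have [] := Ei i.
apply: val_inj => /=; move: pr pr'; rewrite /icell/= => ->; lia.
Qed.

Lemma trivIset_fbox n v : trivIset setT (@fbox n v).
Proof.
move=> t t' _ _ [p [pt pt']].
by have [|_ ->] := @fbox_inj n v v t t' p _ pt pt'.
Qed.

(* The patterns of the configurations with a crossing: saturating the event in
   this way makes it measurable and local. *)
Definition crossing_pattern n : pred {ffun fine_index n -> bool} := fun b =>
  `[< exists eta, crossing L s (mesh n) eta /\ hits (@fbox n (fun=> 0)) eta = b >].

Definition recenter v eta : configuration R d :=
  [set q | eta (q.1 + (\row_i ((v i)%:~R * s)), q.2)].

Lemma hits_recenter n v eta :
  hits (@fbox n (fun=> 0)) (recenter v eta) = hits (@fbox n v) eta.
Proof.
have m0 := mesh_gt0 n; have E := mulr_mesh n.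
have E' (k : int) : k%:~R * s = (k * n.+1%:Z)%:~R * mesh n.
  by rewrite intrM -mulrA -pmulrn E.
have T t q : fbox (fun=> 0) t q <->
    @fbox n v t (q.1 + (\row_i ((v i)%:~R * s)), q.2).
  split=> -[h1 h2]; split => // i; have := h1 i => /(icellP _ _ m0) h;
    apply/(icellP _ _ m0); move: h; rewrite /= !mxE E'.
    rewrite sub0r => h; rewrite !intrD !intrM in h *.
    rewrite intrB; lra.
  rewrite sub0r => h; rewrite !intrD !intrM in h *.
  rewrite intrB in h; lra.
apply/ffunP => t; rewrite !ffunE; apply/asbool_equiv_eq; split.
  move=> [q [eq /T fq]]; by exists (q.1 + (\row_i ((v i)%:~R * s)), q.2).
move=> [q [eq fq]]; exists (q.1 - (\row_i ((v i)%:~R * s)), q.2); split.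
  by rewrite /recenter/= subrK -surjective_pairing.
by apply/T; rewrite /= subrK -surjective_pairing.
Qed.

Lemma recenter_crossing_sat n v eta : crossing L s (mesh n) (recenter v eta) ->
  sat (@fbox n v) (@crossing_pattern n) eta.
Proof.
move=> cr; apply/asboolP; exists (recenter v eta); split=> //.
exact: hits_recenter.
Qed.

(** Equal patterns allow each ball to be exchanged for one in the same fine box. This moves the
    centre by at most [d] meshes and changes the radius by at most one, on top of the initial slack
    of one mesh: hence [d + 2]. *)
Lemma sat_crossing n eta : sat (@fbox n (fun=> 0)) (@crossing_pattern n) eta ->
  crossing L s ((d%:R + 2) * mesh n) eta.
Proof.
have m0 := mesh_gt0 n.
move=> /asboolP[eta' [[x [xs [xL xsL pxs near]]] hE]].
exists x, xs; split=> //.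
  apply: sub_path pxs => y z /le_trans; apply.
  by rewrite ler_peMl ?(ltW m0)// -subr_ge0 addrAC -addrA; rewrite addr_ge0// subr_ge0 ler1n.
move=> z /near[q [eq Wq zq]].
have [t qt] := window_fbox n Wq.
have : hit (fbox (fun=> 0) t) eta.
  apply/asboolP; have /ffunP/(_ t) := hE; rewrite !ffunE => <-.
  by apply/asboolP; exists q.
move=> [p [ep pt]]; exists p; split=> //; first exact: fbox_window pt.
have qp := gcell_dist m0 qt.1 pt.1.
have := enorm_triangle q.1 z p.1.
have /(icellP _ _ m0) := qt.2; have /(icellP _ _ m0) := pt.2.
rewrite intrD mulrDl mul1r; lra.
Qed.

End fine_boxes.

Section poisson_crossing.
Context {R : realType} {d : nat}.
Context {mu : {finite_measure set R -> \bar R}} {l : R}.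
Context {P : probability (configuration R d) R}.
Hypothesis HP : is_poisson_process (boolean_intensity mu l) P.

Lemma measurable_point_count_eq (B : set ('rV[R]_d * R)) (c : \bar R) :
  measurable B ->
  measurable ([set eta | point_count B eta = c] : set (configuration R d)).
Proof.
move=> mB; apply: sub_sigma_algebra; exists B => //; exists [set c].
  exact: emeasurable_set1.
by rewrite setTI.
Qed.

(** The events that the count equals [k] are disjoint, and their probabilities are those of a
    Poisson law, which sum to 1. *)
Lemma poisson_count_finite (B : set ('rV[R]_d * R)) : measurable B ->
  (boolean_intensity mu l B < +oo)%E ->
  P [set eta | infinite_set (eta `&` B)] = 0%E.
Proof.
move=> mB LB; pose E k := [set eta : configuration R d | point_count B eta = k%:R%:E].
have mE k : measurable (E k) by exact: measurable_point_count_eq.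
have tE : trivIset setT E.
  move=> i j _ _ [eta [/= Ei Ej]]; apply/eqP.
  by rewrite -(eqr_nat R); apply/eqP/EFin_inj; rewrite -Ei -Ej.
have UT : \bigcup_k [set k] = [set: nat] by apply/seteqP; split => // k _; exists k.
have PE : P (\bigcup_k E k) = 1%E.
  rewrite measure_semi_bigcup//; last exact: bigcup_measurable.
  rewrite (eq_eseriesr (g := fun k => poisson_prob (fine (boolean_intensity mu l B)) 0%N [set k])).
    rewrite -(@measure_semi_bigcup _ _ _ (poisson_prob (fine (boolean_intensity mu l B)) 0%N) (fun k => [set k]))//.
      by rewrite UT; exact: probability_setT.
    by move=> i j _ _ [k [/= -> ->]].
  move=> k _; exact: (poisson_count HP k mB LB).
have -> : [set eta | infinite_set (eta `&` B)] = ~` (\bigcup_k E k).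
  apply/seteqP; split => eta /= h.
    move=> [k _]; rewrite /E/= /point_count /counting; case: ifPn => // /asboolP f _.
    exact: h.
  move=> f; apply: h.
  have [k kE] : exists k : nat, point_count B eta = k%:R%:E.
    by rewrite /point_count /counting asboolT//; eexists.
  by exists k.
by rewrite probability_setC ?PE ?subee//; exact: bigcup_measurable.
Qed.

Variables (L s : R).
Hypotheses (s0 : 0 < s) (L0 : 0 <= L) (d0 : (0 < d)%N).

Lemma windowE (v : 'I_d -> int) : window s v =
  [set z : 'rV[R]_d | forall i, `[(v i - (4 * d)%:Z)%:~R * s, (v i + (4 * d)%:Z)%:~R * s[%classic (z ord0 i)]
    `*` `[0, s[%classic.
Proof.
by apply/seteqP; split => p [h1 h2]; split => /=; rewrite ?in_itv//= => i;
  have := h1 i; rewrite /= in_itv.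
Qed.

Lemma measurable_window (v : 'I_d -> int) : measurable (window s v).
Proof.
rewrite windowE; apply: measurableX => //.
exact: (@measurable_rV_box _ _ (fun i => `[(v i - (4 * d)%:Z)%:~R * s, (v i + (4 * d)%:Z)%:~R * s[%classic)).
Qed.

Lemma intensity_window (v : 'I_d -> int) :
  (boolean_intensity mu l (window s v) < +oo)%E.
Proof.
rewrite windowE /boolean_intensity product_measure1E//; last first.
  exact: (@measurable_rV_box _ _ (fun i => `[(v i - (4 * d)%:Z)%:~R * s, (v i + (4 * d)%:Z)%:~R * s[%classic)).
rewrite [X in (_ * (X * _))%E](@lebesgue_rV_box _ _ (fun i => `[(v i - (4 * d)%:Z)%:~R * s, (v i + (4 * d)%:Z)%:~R * s[%classic))//.
rewrite -[X in (_ * (_ * X))%E]fineK ?fin_num_measure//.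
rewrite (eq_bigr (fun=> ((8 * d)%:R * s)%:E)); last first.
  move=> i _; rewrite lebesgue_measure_itv/= lte_fin ltr_pM2r// ltr_int.
  rewrite ifT; last lia.
  rewrite -EFinB -mulrBl -rmorphB/= pmulrn; congr (_%:~R * _)%:E; lia.
by rewrite prodEFin -!EFinM ltry.
Qed.

(* A configuration in infinitely many of the saturated events carries chains
   of arbitrarily small slack, hence a true crossing when it is finite. *)
Lemma crossing_pattern_small (a : \bar R) :
  (Pr P (connection (cball 0 L) (sphere 0 (2 * L))) < a)%E ->
  exists n, (P (sat (@fbox _ _ s n (fun=> 0%R)) (@crossing_pattern _ _ L s n)) < a)%E.
Proof.
move=> Pa; pose E n := sat (@fbox _ _ s n (fun=> 0)) (@crossing_pattern R d L s n).
have mE n : measurable (E n).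
  by apply: measurable_sat => t; exact: measurable_fbox.
(* The meshes need not refine one another, so the events [E n] are not known to be monotone;
   continuity from above is applied to their upper limit. *)
pose G n := \bigcup_(m in [set m | (n <= m)%N]) E m.
have mG n : measurable (G n) by exact: bigcup_measurable.
have mI : measurable (\bigcap_n G n) by exact: bigcap_measurable.
have nG : nonincreasing_seq G.
  move=> m n mn; apply/subsetPset => eta [k /= nk Ek].
  by exists k => //=; exact: leq_trans nk.
have cG : P \o G @ \oo --> P (\bigcap_n G n).
  apply: nonincreasing_cvg_mu => //.
  exact: le_lt_trans (probability_le1 _ (mG _)) (ltry _).
have PI : (P (\bigcap_n G n) < a)%E.
  apply: le_lt_trans Pa; rewrite -measurable_mu_extE// /Pr.
  (* [crossing_connection] applies outside this set only; being null, it adds nothing to the outer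
     measure. *)
  pose N := [set eta : configuration R d | infinite_set (eta `&` window s (fun=> 0))].
  apply: (@le_trans _ _ (mu_ext P (connection (cball 0 L) (sphere 0 (2 * L)) `|` N))).
    apply: le_mu_ext => eta h.
    have [f|f] := pselect (finite_set (eta `&` window s (fun=> 0))); last by right.
    left; apply: (crossing_connection (s := s)) => // k k0.
    have dp : 0 < d%:R + 2 :> R by rewrite ltr_wpDl.
    have [n nk] : exists n, (d%:R + 2) * s / k < n%:R.
      by exists (Num.bound ((d%:R + 2) * s / k)); apply: archi_boundP; rewrite ltW// divr_gt0// mulr_gt0.
    have [m /= nm /(sat_crossing s0)] := h n I.
    move=> [x [xs [xL xsL pxs near]]]; exists x, xs.
    have mk : (d%:R + 2) * mesh s m <= k.
      rewrite /mesh mulrA ler_pdivrMr//.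
      move: nk; rewrite ltr_pdivrMr// => /ltW/le_trans; apply.
      by rewrite mulrC ler_wpM2l ?(ltW k0)// ler_nat leqW.
    split=> //.
      by apply: sub_path pxs => y z /le_trans; apply.
    move=> z /near[q [eq Wq zq]]; exists q; split=> //.
    by apply: (le_trans zq); rewrite lerD2l.
  apply: le_trans (@outer_measureU2 _ _ (mu_ext P) _ _) _.
  change (mu_ext P (connection (cball 0 L) (sphere 0 (2 * L))) + mu_ext P N
    <= mu_ext P (connection (cball 0 L) (sphere 0 (2 * L))))%E.
  rewrite -[leRHS]adde0; apply: leeD => //.
  have mN : measurable N.
    rewrite (_ : N = ([set eta | point_count (window s (fun=> 0%R)) eta = +oo%E] : set (configuration R d))).
      by apply: measurable_point_count_eq; exact: measurable_window.
    apply/seteqP; split => eta /=; rewrite /N/= /point_count /counting.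
      by move=> h; rewrite asboolF.
    by case: ifPn => // /asboolP.
  have PN : P N = 0%E.
    apply: poisson_count_finite; first exact: measurable_window.
    exact: intensity_window.
  by rewrite measurable_mu_extE//; apply: (@le_trans _ _ (P N)) => //; rewrite PN.
have := cG _ (open_ereal_lt' PI).
move=> [n _ /(_ n (leqnn n)) Gn]; exists n; apply: le_lt_trans Gn.
apply: le_measure; rewrite ?inE//; first exact: mE.
by move=> eta Ee; exists n => /=.
Qed.

End poisson_crossing.

(** * Bounds on connection probabilities *)

Section poisson_bounds.
Context {R : realType} {d : nat}.
Context {mu : {finite_measure set R -> \bar R}} {l : R}.
Context {P : probability (configuration R d) R}.
Hypothesis l0 : 0 <= l.
Hypothesis HP : is_poisson_process (boolean_intensity mu l) P.
Hypothesis d0 : (0 < d)%N.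

Lemma poisson_hit_box h m (I : set R) : 0 < h -> measurable I ->
  P (hit (gcell h m `*` I)) = (1 - expR (- (l * (h ^+ d * fine (mu I)))))%:E.
Proof.
move=> h0 mI; apply: (poisson_hit HP).
- by apply: measurableX => //; exact: measurable_gcell.
- exact: intensity_box.
- by rewrite !mulr_ge0// ?exprn_ge0 ?(ltW h0)// fine_ge0.
Qed.

Lemma connection_lower_bound (rho L0 : R) : 0 < l -> 0 < rho -> 0 < L0 ->
  0 < fine (mu `[rho, +oo[%classic) ->
  exists2 a, 0 < a & forall r, 0 < r <= L0 ->
    (a%:E <= Pr P (connection (cball 0 r) (sphere 0 (2 * r))))%E.
Proof.
move=> lp rho0 L00 murho.
have dp : 0 < d%:R :> R by rewrite ltr0n.
(* Cells of side [h] have diameter at most [d * h = rho], so a ball of radius at least [rho] centred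
   in such a cell covers it. [J] of them along an axis cover the segment of length [2 * L0], which
   serves all [r <= L0] at once. *)
pose h := rho / d%:R; have h0 : 0 < h by rewrite divr_gt0.
pose J := Num.bound (2 * L0 / h); pose e : 'rV[R]_d := delta_mx ord0 (Ordinal d0).
pose m (j : nat) (i : 'I_d) : int := if i == Ordinal d0 then j%:Z else 0.
pose F (j : 'I_J) := gcell h (m j) `*` `[rho, +oo[%classic.
have mF j : measurable (F j).
  by apply: measurableX => //; exact: measurable_gcell.
have tF : trivIset setT F.
  move=> j j' _ _ [p [[pj _] [pj' _]]]; apply: val_inj => /=.
  have := pj (Ordinal d0); have := pj' (Ordinal d0).
  by rewrite /icell/= /m eqxx => -> [].
pose x := l * (h ^+ d * fine (mu `[rho, +oo[%classic)).
have x0 : 0 < x by rewrite !mulr_gt0// exprn_gt0.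
exists ((1 - expR (- x)) ^+ J).
  by rewrite exprn_gt0// subr_gt0 expR_lt1 oppr_lt0.
move=> r /andP[r0 rL].
pose E := cyl F [ffun=> true].
have mE : measurable E by exact: measurable_cyl.
have PE : P E = ((1 - expR (- x)) ^+ J)%:E.
  rewrite (poisson_cyl HP)// (eq_bigr (fun=> (1 - expR (- x))%:E)).
    by rewrite prodEFin prodr_const card_ord.
  by move=> j _; rewrite ffunE /hitb poisson_hit_box.
rewrite -PE -measurable_mu_extE//; apply: le_mu_ext => eta hE.
exists 0, ((2 * r) *: e); split.
- by rewrite /cball/= subrr enorm0 ltW.
- by rewrite /sphere/= subr0 enormZ enorm_delta mulr1 ger0_norm// mulr_ge0// ltW.
apply: segment_path_connected_in => t /andP[t0 t1].
rewrite subr0 add0r scalerA.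
set u := t * (2 * r).
have u0 : 0 <= u by rewrite !mulr_ge0// ltW.
have uL : u <= 2 * L0.
  apply: (@le_trans _ _ (2 * r)); last by rewrite ler_pM2l.
  by rewrite ler_piMl// mulr_ge0// ltW.
have k0 : 0 <= Num.floor (u / h) by rewrite floor_ge_int divr_ge0// ltW.
have kJ : (`|Num.floor (u / h)| < J)%N.
  rewrite -ltz_nat gez0_abs// floor_lt_int -pmulrn; apply: (@le_lt_trans _ _ (2 * L0 / h)).
    by rewrite ler_pM2r// invr_gt0.
  by apply: archi_boundP; rewrite ltW// divr_gt0// mulr_gt0.
have := hE (Ordinal kJ) I; rewrite ffunE /= => -[q [eq [qF /=]]].
rewrite in_itv/= andbT => qr; exists q => //.
rewrite /cball/=; apply: (@le_trans _ _ (d%:R * h)); last by rewrite /h mulrC divfK ?gt_eqF.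
apply: gcell_dist qF => // i; rewrite /icell/= /m !mxE /= -[i == _]/(i == Ordinal d0).
case: eqP => _; rewrite ?mulr1 ?mulr0 ?mul0r ?floor0//.
by rewrite gez0_abs.
Qed.

Lemma connection0_covered (eta : configuration R d) (Y : set 'rV[R]_d) :
  connection [set 0] Y eta -> exists2 q, eta q & enorm q.1 <= q.2.
Proof.
move=> [x [y [-> _ [g [_ g0 _ gO]]]]].
have [|q eq] := gO 0; first by exists 0 => //=; rewrite in_itv/= lexx ler01.
by rewrite /cball/= enormBC subr0 => ?; exists q.
Qed.

(** A ball covering 0 has its centre there or a positive radius; under either assumption both sets
    of marked points have zero intensity. *)
Lemma Pr_connection0_null (Y : set 'rV[R]_d) :
  l = 0 \/ mu `]0, +oo[%classic = 0%E ->
  (Pr P (connection [set 0%R] Y) = 0)%E.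
Proof.
move=> nul.
pose Z := [set z : 'rV[R]_d | forall i, [set 0] (z ord0 i)].
have mZ : measurable Z by exact: (@measurable_rV_box _ _ (fun=> [set 0])).
pose B1 := Z `*` [set: R]; pose B2 := [set: 'rV[R]_d] `*` (`]0, +oo[%classic : set R).
have mB1 : measurable B1 by exact: measurableX.
have mB2 : measurable B2 by exact: measurableX.
have LZ : lebesgue_rV R d Z = 0%E.
  rewrite /Z (@lebesgue_rV_box _ _ (fun=> [set 0]))//.
  by case: d d0 => // n _; rewrite big_ord_recl lebesgue_measure_set1 mul0e.
have L1 : boolean_intensity mu l B1 = 0%E.
  rewrite /boolean_intensity /B1 product_measure1E//.
  by rewrite [X in (_ * (X * _))%E]LZ mul0e mule0.
have L2 : boolean_intensity mu l B2 = 0%E.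
  rewrite /boolean_intensity; case: nul => [->|mu0]; first by rewrite mul0e.
  by rewrite product_measure1E// [X in (_ * (_ * X))%E]mu0 !mule0.
have H1 : P (hit B1) = 0%E by rewrite (poisson_hit HP mB1 L1)// oppr0 expR0 subrr.
have H2 : P (hit B2) = 0%E by rewrite (poisson_hit HP mB2 L2)// oppr0 expR0 subrr.
apply/eqP; rewrite eq_le mu_ext_ge0// andbT.
apply: (@le_trans _ _ (mu_ext P (hit B1 `|` hit B2))).
  apply: le_mu_ext => eta /connection0_covered[q eq qq].
  have [q0|q0] := eqVneq (enorm q.1) 0.
    left; exists q; split => //; split => //= i; apply/eqP.
    by rewrite -normr_le0 -q0; exact: normr_le_enorm.
  right; exists q; split => //; split => //=.
  by rewrite in_itv/= andbT; apply: lt_le_trans qq; rewrite lt_neqAle eq_sym q0 enorm_ge0.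
rewrite measurable_mu_extE; last by apply: measurableU; exact: measurable_hit.
apply: (@le_trans _ _ (P (hit B1) + P (hit B2))%E).
  by apply: measureU2; exact: measurable_hit.
by rewrite H1 H2 adde0.
Qed.

Lemma exists_charged_radius : mu `]0, +oo[%classic != 0%E ->
  exists2 rho : R, 0 < rho & 0 < fine (mu `[rho, +oo[%classic).
Proof.
move=> mu0; apply: contrapT => h.
have hn n : mu `[(n.+1%:R : R)^-1, +oo[%classic = 0%E.
  apply/eqP; apply: contrapT => /negP mn; apply: h.
  exists (n.+1%:R^-1); first by rewrite invr_gt0.
  by rewrite fine_gt0// lt0e mn measure_ge0/= ltey_eq fin_num_measure.
move/eqP : mu0; apply; apply/eqP; rewrite eq_le measure_ge0 andbT.
rewrite (_ : `]0, +oo[%classic = \bigcup_n `[(n.+1%:R : R)^-1, +oo[%classic); last first.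
  apply/seteqP; split => t /=.
    rewrite in_itv/= andbT => t0; exists (Num.bound (t^-1)) => //.
    rewrite /= in_itv/= andbT invf_ple ?posrE// ltW//.
    apply: lt_le_trans (archi_boundP _) _; first by rewrite invr_ge0 ltW.
    by rewrite ler_nat leqnSn.
  by move=> [n _]; rewrite /= !in_itv/= !andbT; apply: lt_le_trans; rewrite invr_gt0.
pose F n : set R := `[(n.+1%:R : R)^-1, +oo[%classic.
have : (mu (\bigcup_n F n) <= \sum_(n <oo) mu (F n))%E.
  apply: measure_sigma_subadditive => //; first by move=> n; exact: measurable_itv.
  by apply: bigcup_measurable => n _; exact: measurable_itv.
by rewrite eseries0// => n _ _; exact: hn.
Qed.

End poisson_bounds.

Lemma nneseries_geometric_le (R : realType) (u : (\bar R)^nat) (K : R) :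
  (0 <= K) -> (forall n, 0 <= u n)%E -> (forall n, (u n <= (K / 2 ^+ n)%:E)%E) ->
  (\sum_(n <oo) u n <= (2 * K)%:E)%E.
Proof.
move=> K0 u0 uK; have := @epsilon_trick0 R (2 * K) predT.
rewrite mulr_ge0// => /(_ isT); apply: le_trans; apply: lee_nneseries => // n _.
apply: le_trans (uK n) _; rewrite lee_fin natrX exprS invfM mulrACA.
by rewrite divff ?mul1r// pnatr_eq0.
Qed.

Lemma fine_mu_icell_le (R : realType) (mu : {finite_measure set R -> \bar R}) (c : R)
    (mu_tail : forall r : R, 1 <= r -> (mu `[r, +oo[%classic <= (expR (- (c * r)))%:E)%E)
    (s : R) (n : nat) : 1 <= s -> (0 < n)%N ->
  fine (mu (icell s n%:Z)) <= expR (- (c * s)) ^+ n.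
Proof.
move=> s1 n0; have s0 : 0 < s by exact: lt_le_trans s1.
have sn1 : 1 <= s * n%:R by rewrite -[leLHS]mulr1 ler_pM ?ler01// ler1n.
rewrite -lee_fin fineK; last by rewrite fin_num_measure//; exact: measurable_icell.
apply: (@le_trans _ _ (mu `[s * n%:R, +oo[%classic)).
  apply: le_measure; rewrite ?inE//; first exact: measurable_icell.
  by move=> t /(icellP _ _ s0)/andP[h _]; rewrite /= in_itv/= andbT mulrC.
apply: le_trans (mu_tail _ sn1) _.
by rewrite lee_fin -expRM_natl (_ : n%:R * _ = - (c * (s * n%:R)))//; ring.
Qed.

Section covered.
Context {R : realType} {d : nat}.
Context {mu : {finite_measure set R -> \bar R}} {l c : R}.
Context {P : probability (configuration R d) R}.
Hypothesis l0 : 0 <= l.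
Hypothesis HP : is_poisson_process (boolean_intensity mu l) P.
Hypothesis c0 : 0 < c.
Hypothesis mu_tail : forall r : R, 1 <= r ->
  (mu `[r, +oo[%classic <= (expR (- (c * r)))%:E)%E.

Lemma exists_scale_expR_le (B : R) : 1 <= B -> exists2 s0 : R, 1 <= s0 &
  forall s, s0 <= s -> expR (- (c * s)) <= B^-1.
Proof.
move=> B1; exists (1 + B / c).
  by rewrite lerDl divr_ge0 ?(ltW c0)// (le_trans ler01).
move=> s ss0; have B0 : 0 < B by exact: lt_le_trans B1.
rewrite expRN lef_pV2 ?posrE ?expR_gt0//.
apply: le_trans (expR_ge1Dx _).
have : B <= c * s; last lra.
apply: (@le_trans _ _ (c * (1 + B / c))); last by rewrite ler_pM2l.
by rewrite mulrDr mulr1 mulrCA divff ?gt_eqF// mulr1 lerDr ltW.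
Qed.

(** A connection from 0 requires 0 to be covered. By the tail of [mu], the marked points whose ball
    covers 0 lie in a set of finite intensity, which is empty of points with positive probability.
    The bound serves the distances that are too short for the union bound over chains. *)
Lemma Pr_connection0_lt1 : exists2 q : R, q < 1 &
  forall Y, (Pr P (connection [set 0%R] Y) <= q%:E)%E.
Proof.
(* The factor [2 ^+ d] absorbs the volume, as [n.+1 ^ d <= (2 ^ d) ^ n]; the remaining factor 2
   makes the series geometric. *)
have [|s s1 es] := @exists_scale_expR_le (2 ^+ d.+1); first by rewrite exprn_ege1// ler1n.
have s0 : 0 < s by exact: lt_le_trans s1.
have {}es := es s (lexx _).
pose Z (n : nat) := [set z : 'rV[R]_d | forall i, `[- (n.+1%:R * s), n.+1%:R * s]%classic (z ord0 i)].
have mZ n : measurable (Z n).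
  exact: (@measurable_rV_box _ _ (fun=> `[- (n.+1%:R * s), n.+1%:R * s]%classic)).
have LZ n : lebesgue_rV R d (Z n) = ((2 * (n.+1%:R * s)) ^+ d)%:E.
  rewrite /Z (@lebesgue_rV_box _ _ (fun=> `[- (n.+1%:R * s), n.+1%:R * s]%classic))//.
  rewrite (eq_bigr (fun=> (2 * (n.+1%:R * s))%:E)).
    by rewrite prodEFin prodr_const card_ord.
  move=> i _; have : 0 < n.+1%:R * s by rewrite mulr_gt0.
  move: (n.+1%:R * s) => a a0; rewrite lebesgue_measure_itv/= lte_fin.
  by rewrite ifT -?EFinB ?opprK ?mulr_natl ?mulr2n//; lra.
pose B n := Z n `*` icell s n%:Z.
have mB n : measurable (B n) by apply: measurableX => //; exact: measurable_icell.
pose nu := (lebesgue_rV R d \x mu)%E.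
(* The radii below [s] are not controlled by the tail bound; the total mass is used for them. *)
pose M := Num.max 1 (fine (mu setT)).
have M1 : 1 <= M by rewrite le_max lexx.
pose K := (2 * s) ^+ d * M.
have K0 : 0 <= K by rewrite mulr_ge0 ?exprn_ge0 ?mulr_ge0// ?(ltW s0)// (le_trans ler01).
have nuB n : (nu (B n) <= (K / 2 ^+ n)%:E)%E.
  have -> : nu (B n) = ((2 * (n.+1%:R * s)) ^+ d * fine (mu (icell s n%:Z)))%:E.
    rewrite /nu /B product_measure1E//; last exact: measurable_icell.
    rewrite [X in (X * _)%E]LZ EFinM fineK// fin_num_measure//.
    exact: measurable_icell.
  rewrite lee_fin mulrCA exprMn [X in X * _]mulrC /K -!mulrA ler_wpM2l//.
    by rewrite exprn_ge0// mulr_ge0// ltW.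
  have n2 : n.+1%:R ^+ d <= (2 ^+ d) ^+ n :> R.
    by rewrite -exprM mulnC exprM lerXn2r ?nnegrE ?exprn_ge0// -natrX ler_nat ltn_expl.
  have mun : fine (mu (icell s n%:Z)) <= M * ((2 ^+ d.+1)^-1) ^+ n.
    case: n {n2} => [|n].
      rewrite expr0 mulr1 le_max; apply/orP; right.
      rewrite fine_le// ?fin_num_measure//; try exact: measurable_icell.
      by apply: le_measure; rewrite ?inE//; exact: measurable_icell.
    apply: le_trans (fine_mu_icell_le mu_tail s1 _) _ => //.
    rewrite -[leLHS]mul1r ler_pM ?exprn_ge0 ?expR_ge0//.
    by rewrite lerXn2r ?nnegrE ?expR_ge0// invr_ge0 exprn_ge0.
  apply: (@le_trans _ _ ((2 ^+ d) ^+ n * (M * ((2 ^+ d.+1)^-1) ^+ n))).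
    by rewrite ler_pM ?exprn_ge0 ?fine_ge0.
  rewrite mulrCA ler_wpM2l// ?(le_trans ler01)//.
  have -> : (2 ^+ d) ^+ n * (2 ^+ d.+1)^-1 ^+ n = (2 ^+ n)^-1 :> R.
    rewrite -exprMn -[RHS]exprVn; congr (_ ^+ n).
    by rewrite exprSr invfM mulrA divff ?mul1r// expf_neq0// pnatr_eq0.
  exact: lexx.
pose UB := \bigcup_n B n.
have mUB : measurable UB by exact: bigcup_measurable.
have nuUB : (nu UB <= (2 * K)%:E)%E.
  apply: le_trans (nneseries_geometric_le K0 _ nuB) => //.
  exact: measure_sigma_subadditive.
have nuf : nu UB \is a fin_num.
  by rewrite ge0_fin_numE//; apply: le_lt_trans nuUB (ltry _).
pose x := l * fine (nu UB).
have LUB : boolean_intensity mu l UB = x%:E.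
  by rewrite /boolean_intensity EFinM fineK.
have x0 : 0 <= x by rewrite mulr_ge0// fine_ge0.
exists (1 - expR (- x)); first by rewrite ltrBlDr ltrDl expR_gt0.
move=> Y; rewrite -(poisson_hit HP mUB LUB x0) -measurable_mu_extE; last exact: measurable_hit.
apply: le_mu_ext => eta /connection0_covered[q eq qq].
have q0 : 0 <= q.2 := le_trans (enorm_ge0 _) qq.
have f0 : 0 <= Num.floor (q.2 / s) by rewrite floor_ge_int divr_ge0// ltW.
exists q; split => //; exists `|Num.floor (q.2 / s)|%N => //.
have qn : icell s `|Num.floor (q.2 / s)|%N%:Z q.2 by rewrite /icell/= gez0_abs.
split=> //= i; have /(icellP _ _ s0)/andP[_] := qn.
rewrite -PoszD addn1 -pmulrn => ql; rewrite /= in_itv/= -ler_norml.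
by apply: le_trans (ltW ql); apply: le_trans qq; exact: normr_le_enorm.
Qed.

End covered.

(** * Union bound over chains of objects *)

Lemma outer_measure_bigcup_fin (R : realType) (T : Type)
    (mu : {outer_measure set T -> \bar R}) (I : finType) (F : I -> set T) :
  (mu (\bigcup_(i in [set: I]) F i) <= \sum_i mu (F i))%E.
Proof.
suff H (s : seq I) : (mu [set t | exists2 i, i \in s & F i t] <= \sum_(i <- s) mu (F i))%E.
  apply: le_trans (H (index_enum I)); apply: le_outer_measure => t [i _ Ft].
  by exists i => //; rewrite mem_index_enum.
elim: s => [|a s IH].
  rewrite big_nil (_ : [set _ | _] = set0) ?outer_measure0//.
  by apply/seteqP; split => // t [i].
rewrite big_cons; apply: le_trans (leeD (lexx _) IH).
apply: le_trans (outer_measureU2 _ _ _); apply: le_outer_measure => t [i].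
by rewrite inE => /orP[/eqP ->|si] Ft; [left|right; exists i].
Qed.

Section chains.
Context {R : realType} {d : nat}.
Variable C : nat.

(* [(v, 0)] is a local crossing around the cell [v]; [(v, k)] with [0 < k] is a
   ball centred in the cell [v] with radius in [k s, (k + 1) s[. *)
Definition object : choiceType := ({ffun 'I_d -> int} * nat)%type.

(** Each object [o] of a chain is within [o.2 + C] cells of a point of the path, and consecutive
    points of the path are in equal or neighbouring cells: hence twice [C], plus 1. *)
Definition linked : rel object := fun o o' =>
  [forall i, `|(o.1 i - o'.1 i)%R|%N <= o.2 + o'.2 + C.*2.+1]%N.

(** Summing the tolerances of [linked] along a chain counts each radius twice, once for each of the
    two links of the object. *)
Definition reach (o : object) : nat := (o.2.*2 + C.*2.+1)%N.

Definition total_reach (os : seq object) : nat := (\sum_(o <- os) reach o)%N.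

(* The constants make [weight_step] gain 1/2 per object, after summation over
   the successors, against the factor 2 paid per unit of reach. *)
Definition weight_factor : R := (((4 * C + 3) ^ d * 2 ^ (2 * C + 3))%N%:R)^-1.

Definition weight (o : object) : R :=
  weight_factor * ((8 * (2 ^ d) ^ 2)%N%:R^-1) ^+ o.2.

Definition origin : object := ([ffun=> 0], 0%N).

Lemma weight_factor_gt0 : 0 < weight_factor.
Proof. by rewrite invr_gt0 ltr0n muln_gt0 !expn_gt0 /= addn_gt0 orbT. Qed.

Lemma weight_ge0 o : 0 <= weight o.
Proof. by rewrite mulr_ge0 ?ltW ?weight_factor_gt0// exprn_ge0// invr_ge0. Qed.

(** Here [n] and [k] are the radius indices of an object and of its successor, and the first factor
    counts the possible cells of the successor; it is at most [(4 * C + 3) ^ d * (2 ^ d) ^ (n + k)].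
    In [weight], one factor [2 ^ d] pays for the [k] in this count and the other for the potential
    [(2 ^+ d) ^+ k] handed to the next step; of the factor 8, 4 pays for the reach and 2 for the
    summation over [k]. *)
Lemma weight_step (n k : nat) :
  ((2 * (n + k + C.*2.+1)).+1 ^ d)%:R *
    (weight_factor * ((8 * (2 ^ d) ^ 2)%N%:R^-1) ^+ k * 2 ^+ (k.*2 + C.*2.+1)
      * (2 ^+ d) ^+ k)
  <= (2 ^+ d) ^+ n / 4 / 2 ^+ k :> R.
Proof.
have b1 : ((2 * (n + k + C.*2.+1)).+1 ^ d <= (4 * C + 3) ^ d * (2 ^ d) ^ (n + k))%N.
  have -> : ((4 * C + 3) ^ d * (2 ^ d) ^ (n + k) = ((4 * C + 3) * 2 ^ (n + k)) ^ d)%N.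
    by rewrite expnMn; congr (_ * _)%N; rewrite -!expnM mulnC.
  case: d => [//|e]; rewrite leq_exp2r//.
  apply: (@leq_trans ((4 * C + 3) * (n + k).+1)); first by rewrite -muln2; nia.
  by rewrite leq_mul2l ltn_expl// orbT.
apply: (@le_trans _ _ (((4 * C + 3) ^ d * (2 ^ d) ^ (n + k))%N%:R *
  (weight_factor * ((8 * (2 ^ d) ^ 2)%N%:R^-1) ^+ k * 2 ^+ (k.*2 + C.*2.+1)
      * (2 ^+ d) ^+ k))).
  by rewrite ler_wpM2r ?ler_nat// !mulr_ge0 ?exprn_ge0 ?invr_ge0.
rewrite le_eqVlt; apply/orP; left; apply/eqP; rewrite /weight_factor.
have -> : ((4 * C + 3) ^ d * (2 ^ d) ^ (n + k))%N%:R =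
    (4 * C + 3)%N%:R ^+ d * ((2 ^+ d) ^+ n * (2 ^+ d) ^+ k) :> R.
  by rewrite natrM !natrX exprD.
have -> : ((4 * C + 3) ^ d * 2 ^ (2 * C + 3))%N%:R =
    (4 * C + 3)%N%:R ^+ d * (2 ^+ (2 * C) * 8) :> R.
  by rewrite natrM !natrX exprD; congr (_ * (_ * _)); ring.
have -> : ((8 * (2 ^ d) ^ 2)%N%:R^-1) ^+ k =
    ((2 ^+ k) ^+ 3 * ((2 ^+ d) ^+ k) ^+ 2)^-1 :> R.
  rewrite exprVn natrM !natrX exprMn; congr (_ * _)^-1; rewrite -!exprM.
    by rewrite (_ : 8 = 2 ^+ 3) -?exprM 1?mulnC//; ring.
  by congr (_ ^+ _); rewrite -!mulnA [(k * 2)%N]mulnC.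
have -> : 2 ^+ (k.*2 + C.*2.+1) = (2 ^+ k) ^+ 2 * (2 ^+ (2 * C) * 2) :> R.
  by rewrite exprD exprSr -!muln2 exprM [(C * 2)%N]mulnC.
have p (m : nat) : 2 ^+ m != 0 :> R by rewrite expf_neq0.
have q : ((4 * C + 3)%N%:R : R) ^+ d != 0 by rewrite expf_neq0// pnatr_eq0 addn3.
have q' : ((2 ^+ d) ^+ k : R) != 0 by rewrite expf_neq0.
move: (p k) (p (2 * C)%N) q q'.
move: (2 ^+ k) (2 ^+ (2 * C)) ((4 * C + 3)%N%:R ^+ d) ((2 ^+ d) ^+ k) ((2 ^+ d) ^+ n).
move=> t E A gk gn t0 E0 A0 g0; field.
by rewrite A0 E0 t0 g0.
Qed.


Lemma linkedP (o o' : object) :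
  reflect (forall i, `|(o.1 i - o'.1 i)%R|%N <= o.2 + o'.2 + C.*2.+1)%N (linked o o').
Proof. exact: forallP. Qed.

Section union_bound.
Context {T : Type} (mu : {outer_measure set T -> \bar R}) (M : object -> set T).
Hypothesis muM : forall os, uniq os ->
  (mu [set t | forall o, o \in os -> M o t] <= (\prod_(o <- os) weight o)%:E)%E.
Variable rho : nat.

Definition chain_extension (m : nat) (os : seq object) : set T :=
  [set t | exists q, [/\ size q = m, path linked (last origin os) q, uniq (os ++ q),
     forall o, o \in os ++ q -> M o t & (rho <= total_reach (os ++ q))%N]].

(** A Chernoff bound, by induction on the number [m] of objects still to come. The quotient of
    [2 ^+ total_reach os] by [2 ^+ rho] is at least 1 for a complete chain. The power of [2 ^+ d]
    pays in advance for the number of successors, which grows with the last radius. *)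
Lemma chain_extension_le m os :
  (mu (chain_extension m os) <=
   ((\prod_(o <- os) weight o) * 2 ^+ total_reach os * (2 ^+ d) ^+ (last origin os).2
    / 2 ^+ m / 2 ^+ rho)%:E)%E.
Proof.
have w0 (os' : seq object) : 0 <= \prod_(o <- os') weight o.
  by apply: prodr_ge0 => o _; exact: weight_ge0.
elim: m os => [|m IH] os.
  have [/andP[uos ros]|h] := boolP (uniq os && (rho <= total_reach os)%N); last first.
    rewrite (_ : chain_extension 0 os = set0); last first.
      apply/seteqP; split => // t [q [/size0nil -> _]].
      by rewrite cats0 => u _ r; move/negP : h; apply; rewrite u.
    by rewrite outer_measure0 lee_fin !mulr_ge0 ?invr_ge0 ?exprn_ge0.
  apply: (@le_trans _ _ (\prod_(o <- os) weight o)%:E).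
    apply: le_trans (muM uos); apply: le_outer_measure => t [q [/size0nil -> _]].
    by rewrite cats0.
  rewrite lee_fin expr0 divr1 -!mulrA ler_peMr//.
  rewrite mulrCA -[leLHS]mul1r ler_pM//.
    by rewrite exprn_ege1// exprn_ege1// ler1n.
  by rewrite -exprB ?unitfE ?exprn_ege1 ?ler1n// pnatr_eq0.
pose o := last origin os.
pose r k := (o.2 + k + C.*2.+1)%N.
pose ext k (f : {ffun 'I_d -> 'I_(2 * r k).+1}) : object :=
  ([ffun i => o.1 i + (f i : nat)%:Z - (r k)%:Z], k).
pose F k := \bigcup_(f in [set: {ffun 'I_d -> 'I_(2 * r k).+1}])
  chain_extension m (rcons os (ext k f)).
pose K := (\prod_(o <- os) weight o) * 2 ^+ total_reach os * (2 ^+ d) ^+ o.2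
    / 2 ^+ m.+1 / 2 ^+ rho.
have K0 : 0 <= K by rewrite /K !mulr_ge0 ?invr_ge0 ?exprn_ge0.
apply: (@le_trans _ _ (mu (\bigcup_k F k))).
  apply: le_outer_measure => t [q [sq pq uq Mq rq]].
  case: q sq pq uq Mq rq => [//|o' q] /= [sq] /andP[oo' pq] uq Mq rq.
  have /linkedP nr := oo'.
  have H0 i : 0 <= o'.1 i - o.1 i + (r o'.2)%:Z.
    have := nr i; rewrite -/o /r; lia.
  have H i : (`|(o'.1 i - o.1 i + (r o'.2)%:Z)%R|%N < (2 * r o'.2).+1)%N.
    have := nr i; rewrite -/o /r; lia.
  exists o'.2 => //; exists [ffun i => Ordinal (H i)] => //.
  have -> : ext o'.2 [ffun i => Ordinal (H i)] = o'.
    rewrite [RHS]surjective_pairing /ext; congr pair; apply/ffunP => i.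
    rewrite !ffunE /= gez0_abs; first by rewrite addrA addrK addrCA subrr addr0.
    exact: H0.
  by exists q; rewrite cat_rcons last_rcons; split.
apply: le_trans (outer_measure_sigma_subadditive mu F) _.
(* The successors of radius index [k] contribute at most [K / 2 / 2 ^+ k]. *)
apply: (@le_trans _ _ (2 * (K / 2))%:E); last first.
  by rewrite lee_fin mulrCA divff ?mulr1// pnatr_eq0.
apply: nneseries_geometric_le => [|?|k]; [by rewrite divr_ge0|exact: outer_measure_ge0|].
rewrite /F; apply: le_trans (outer_measure_bigcup_fin _ _) _.
pose X := (\prod_(o <- os) weight o) * 2 ^+ total_reach os / 2 ^+ m / 2 ^+ rho.
have X0 : 0 <= X by rewrite /X !mulr_ge0 ?invr_ge0 ?exprn_ge0.
pose Y := weight_factor * ((8 * (2 ^ d) ^ 2)%N%:R^-1) ^+ k * 2 ^+ (k.*2 + C.*2.+1)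
      * (2 ^+ d) ^+ k.
apply: (@le_trans _ _ (\sum_(f : {ffun 'I_d -> 'I_(2 * r k).+1}) (X * Y)%:E)%E).
  apply: lee_sum => f _; apply: le_trans (IH _) _; rewrite last_rcons/=.
  rewrite -cats1 big_cat big_seq1 /total_reach big_cat big_seq1 /= /reach /= exprD.
  by rewrite lee_fin le_eqVlt; apply/orP; left; apply/eqP; rewrite /X /Y /weight/=; ring.
rewrite sumEFin lee_fin sumr_const card_ffun !card_ord -[leLHS]mulr_natl mulrCA.
apply: le_trans (ler_wpM2l X0 (weight_step o.2 k)) _.
rewrite le_eqVlt; apply/orP; left; apply/eqP; rewrite /X /K exprS.
have p (j : nat) : 2 ^+ j != 0 :> R by rewrite expf_neq0.
move: (p m) (p rho) (p k).
move: (2 ^+ m) (2 ^+ rho) (2 ^+ k) => a b e a0 b0 e0; field.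
by rewrite a0 b0 e0.
Qed.

Lemma chain_le :
  (mu [set t | exists q, [/\ path linked origin q, uniq q,
     forall o, o \in q -> M o t & (rho <= total_reach q)%N]] <= (2 / 2 ^+ rho)%:E)%E.
Proof.
apply: (@le_trans _ _ (mu (\bigcup_m chain_extension m [::]))).
  by apply: le_outer_measure => t [q [pq uq Mq rq]]; exists (size q) => //; exists q.
apply: le_trans (outer_measure_sigma_subadditive mu _) _.
apply: nneseries_geometric_le => [|?|m].
- by rewrite invr_ge0 exprn_ge0.
- exact: outer_measure_ge0.
apply: le_trans (chain_extension_le _ _) _.
by rewrite big_nil /total_reach big_nil /= !expr0 !mul1r lee_fin mulrC.
Qed.

End union_bound.
End chains.

(** * Bad objects of the Boolean model *)

Section bad_objects.
Context {R : realType} {d : nat}.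
Variables (L s : R) (n : nat).
Hypothesis s0 : 0 < s.
Implicit Types (o : @object d).

(** All objects share one index type, so that the independence lemma applies to families of both
    kinds: [Some] indexes the fine boxes of a crossing, [None] the box of a big ball, and the slots
    of the other kind are empty. *)
Definition object_box o (t : option (fine_index (d := d) n)) : set ('rV[R]_d * R) :=
  match t with
  | Some u => if o.2 == 0%N then fbox s o.1 u else set0
  | None => if o.2 == 0%N then set0 else gcell s o.1 `*` icell s (o.2)%:Z
  end.

Definition object_pattern o : pred {ffun option (fine_index (d := d) n) -> bool} :=
  fun b => if o.2 == 0%N then crossing_pattern L s [ffun u => b (Some u)] else b None.

Definition bad o : set (configuration R d) := sat (object_box o) (object_pattern o).

(** The modulus is the width of a window in cells, so distinct windows with equal residues are
    disjoint. [inord] lands in a successor type, whence the count [(8 * d).+1 ^ d] of classes. *)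
Definition residue o : {ffun 'I_d -> 'I_(8 * d).+1} :=
  [ffun i => inord `|(o.1 i %% (8 * d)%N%:Z)%Z|%N].

Lemma measurable_object_box o t : measurable (object_box o t).
Proof.
case: t => [u|] /=; case: ifP => // _; first exact: measurable_fbox.
by apply: measurableX; [exact: measurable_gcell|exact: measurable_icell].
Qed.

Lemma measurable_bad o : measurable (bad o).
Proof. by apply: measurable_sat => t; exact: measurable_object_box. Qed.

Lemma residueP o o' : (0 < d)%N -> residue o = residue o' ->
  forall i, (o.1 i = o'.1 i %[mod (8 * d)%N%:Z])%Z.
Proof.
move=> d0 /ffunP E i; have := E i; rewrite !ffunE => /(congr1 (@nat_of_ord _)).
have D0 : (8 * d)%N%:Z != 0 by rewrite eqz_nat muln_eq0 negb_or/= -lt0n.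
have h (z : int) : (0 <= (z %% (8 * d)%N%:Z)%Z) && ((z %% (8 * d)%N%:Z)%Z < (8 * d)%N%:Z).
  by rewrite modz_ge0//= ltz_pmod// ltz_nat muln_gt0.
have /andP[h1 h2] := h (o.1 i); have /andP[h3 h4] := h (o'.1 i).
rewrite !inordK; first by lia.
all: by move: h1 h2 h3 h4; move: ((o.1 i %% (8 * d)%N%:Z)%Z) ((o'.1 i %% (8 * d)%N%:Z)%Z) => *; lia.
Qed.

Lemma fbox_floor (v : 'I_d -> int) (u : fine_index n) p :
  fbox s v u p -> Num.floor (p.2 / s) = 0.
Proof.
move=> /(fbox_window s0)[_ /andP[p0 ps]]; apply: floor_def.
by rewrite divr_ge0 ?(ltW s0)//= ltr_pdivrMr// mul1r.
Qed.

Lemma object_box_inj o o' t t' p : (0 < d)%N -> residue o = residue o' ->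
  object_box o t p -> object_box o' t' p -> o = o' /\ t = t'.
Proof.
move=> d0 /(residueP d0) oo'.
case: t t' => [u|] [u'|] /=; case: eqVneq => o2 //; case: eqVneq => o2' //.
- move=> pu pu'; have [vv ->] := fbox_inj s0 oo' pu pu'; split=> //.
  rewrite (surjective_pairing o) (surjective_pairing o') o2 o2'; congr pair.
  by apply/ffunP.
- by move=> /fbox_floor E [_]; rewrite /icell/= E => -[E']; move: o2'; rewrite -E'.
- by move=> [_ +] /fbox_floor E; rewrite /icell/= E => -[E']; move: o2; rewrite -E'.
- move=> [pz pr] [pz' pr']; split=> //.
  rewrite (surjective_pairing o) (surjective_pairing o'); congr pair.
    by apply/ffunP => i; rewrite -(pz i) -(pz' i).
  by move: pr pr'; rewrite /icell/= => -> [].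
Qed.

Section probability.
Context {mu : {finite_measure set R -> \bar R}} {l : R}.
Context {P : probability (configuration R d) R}.
Hypotheses (l0 : 0 <= l) (d0 : (0 < d)%N).
Hypothesis HP : is_poisson_process (boolean_intensity mu l) P.

Lemma bad_same_residue (os : seq object) c : uniq os ->
  (forall o, o \in os -> residue o = c) ->
  fine (P [set eta | forall o, o \in os -> bad o eta]) =
  \prod_(o <- os) fine (P (bad o)).
Proof.
move=> uos osc; pose F (i : 'I_(size os)) := object_box (tnth (in_tuple os) i).
rewrite big_tnth -(@fine_poisson_sat_indep _ _ _ _ HP _ _ F
  (fun i => object_pattern (tnth (in_tuple os) i))).
- congr (fine (P _)); apply/seteqP; split => eta h.
    by move=> i _; apply: h; exact: mem_tnth.
  by move=> o /(tnthP (in_tuple os))[i ->]; exact: h i I.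
- by move=> i t; exact: measurable_object_box.
- move=> [i t] [i' t'] _ _ [p [/= pi pi']].
  have [|E ->] := object_box_inj d0 _ pi pi'.
    by rewrite (osc _ (mem_tnth i (in_tuple os))) (osc _ (mem_tnth i' (in_tuple os))).
  congr pair; apply: val_inj => /=; apply/eqP.
  move: E; rewrite !(tnth_nth origin) /= => /eqP.
  by rewrite nth_uniq.
Qed.

Lemma measurable_all_bad (os : seq object) :
  measurable ([set eta | forall o, o \in os -> bad o eta] : set (configuration R d)).
Proof.
elim: os => [|o os IH].
  by rewrite (_ : [set _ | _] = setT)//; apply/seteqP; split.
rewrite (_ : [set _ | _] = bad o `&` [set eta | forall o, o \in os -> bad o eta]).
  by apply: measurableI => //; exact: measurable_bad.
apply/seteqP; split => eta.
  move=> h; split; first by apply: h; rewrite inE eqxx.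
  by move=> o' oo'; apply: h; rewrite inE oo' orbT.
by move=> [h1 h2] o'; rewrite inE => /orP[/eqP ->|/h2].
Qed.

(* Each residue class bounds the probability by a product of independent
   factors; multiplying the bounds over the classes costs a power, their number. *)
Lemma all_bad_le (os : seq object) (w : object -> R) : uniq os ->
  (forall o, 0 <= w o) ->
  (forall o, (P (bad o) <= (w o ^+ ((8 * d).+1 ^ d)%N)%:E)%E) ->
  (mu_ext P [set eta | forall o, o \in os -> bad o eta] <= (\prod_(o <- os) w o)%:E)%E.
Proof.
move=> uos w0 hw; set K := (_ ^ _)%N in hw.
have K0 : (0 < K)%N by rewrite expn_gt0.
have mA := measurable_all_bad.
rewrite measurable_mu_extE// -[leLHS]fineK ?fin_num_measure// lee_fin.
rewrite -(ler_pXn2r K0) ?nnegrE ?fine_ge0//; last first.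
  by apply: prodr_ge0.
have -> : (fine (P [set eta | forall o, o \in os -> bad o eta])) ^+ K =
    \prod_(c : {ffun 'I_d -> 'I_(8 * d).+1})
      fine (P [set eta | forall o, o \in os -> bad o eta]).
  by rewrite prodr_const card_ffun !card_ord.
apply: (@le_trans _ _ (\prod_(c : {ffun 'I_d -> 'I_(8 * d).+1})
    \prod_(o <- os | residue o == c) fine (P (bad o)))).
  apply: ler_prod => c _; rewrite fine_ge0//= -big_filter.
  rewrite -(@bad_same_residue _ c) ?filter_uniq//; last first.
    by move=> o; rewrite mem_filter => /andP[/eqP].
  rewrite fine_le ?fin_num_measure//; apply: le_measure; rewrite ?inE//.
  by move=> eta h o; rewrite mem_filter => /andP[_ /h].
rewrite (exchange_big_dep predT)//= -prodrXl; apply: ler_prod => o _.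
rewrite (big_pred1 (residue o)); last by move=> c; rewrite /= eq_sym.
rewrite fine_ge0//= -lee_fin fineK ?fin_num_measure//.
exact: measurable_bad.
Qed.

(** The probability of a set of patterns depends only on the intensities of the boxes, which are the
    same around every cell. This gives translation invariance without translating the process. *)
Lemma P_bad_small o (a : \bar R) : o.2 = 0%N ->
  (P (sat (@fbox _ _ s n (fun=> 0%R)) (@crossing_pattern _ _ L s n)) < a)%E ->
  (P (bad o) <= a)%E.
Proof.
move=> o2; have -> : bad o = sat (@fbox R d s n o.1) (@crossing_pattern R d L s n).
  have E eta : [ffun u => hits (object_box o) eta (Some u)] = hits (@fbox R d s n o.1) eta.
    by apply/ffunP => u; rewrite !ffunE /object_box o2.
  by apply/seteqP; split => eta; rewrite /bad /sat /object_pattern /= o2 eqxx E.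
have -> : P (sat (@fbox R d s n o.1) (@crossing_pattern R d L s n)) =
    P (sat (@fbox R d s n (fun=> 0)) (@crossing_pattern R d L s n)).
  have mf v t : measurable (@fbox R d s n v t) by exact: measurable_fbox.
  have ms v : measurable (sat (@fbox R d s n v) (@crossing_pattern R d L s n)).
    exact: measurable_sat.
  rewrite -[LHS]fineK ?fin_num_measure// -[RHS]fineK ?fin_num_measure//.
  rewrite !(fine_poisson_sat HP)//; try exact: trivIset_fbox.
  congr EFin; apply: eq_bigr => b _; apply: eq_bigr => t _.
  have Ph v : P (hit (@fbox R d s n v t)) =
      (1 - expR (- (l * (mesh s n ^+ d * fine (mu (icell (mesh s n) (t.2 : nat)%:Z))))))%:E.
    apply: (poisson_hit_box l0 HP); first exact: mesh_gt0.
    by apply: measurable_icell; exact: mesh_gt0.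
  rewrite /hitb; case: (b t); first by rewrite !Ph.
  by rewrite !probability_setC ?Ph//; exact: measurable_hit.
exact: ltW.
Qed.

Lemma P_bad_big o : (0 < o.2)%N ->
  (P (bad o) <= (l * (s ^+ d * fine (mu (icell s (o.2)%:Z))))%:E)%E.
Proof.
move=> o2; have o2' : (o.2 == 0%N) = false by rewrite gtn_eqF.
have -> : bad o = hit (gcell s o.1 `*` icell s (o.2)%:Z).
  by apply/seteqP; split => eta; rewrite /bad /sat /object_pattern /= o2' ffunE /=
    ?o2' => /asboolP.
rewrite (poisson_hit_box l0 HP)//; last exact: measurable_icell.
rewrite lee_fin lerBlDr -lerBlDl.
by have := expR_ge1Dx (- (l * (s ^+ d * fine (mu (icell s (o.2)%:Z))))).
Qed.

End probability.
End bad_objects.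

(** * From a long path to a chain of bad objects *)

Lemma path_first_hit (T : eqType) (e : rel T) (p : pred T) x ys :
  path e x ys -> ~~ p x -> p (last x ys) ->
  exists zs y, [/\ path e x (rcons zs y), all (predC p) (x :: zs), p y &
    {subset rcons zs y <= ys}].
Proof.
elim: ys x => [|y ys IH] x /=; first by move=> _ /negPf ->.
move=> /andP[xy pys] px ply; have [py|py] := boolP (p y).
  exists [::], y; split=> //=; rewrite ?xy ?px//.
  by move=> z; rewrite inE => /eqP ->; rewrite inE eqxx.
have [zs [z [pz az qz sz]]] := IH y pys py ply.
exists (y :: zs), z; split=> //=; first by rewrite xy.
  by rewrite px.
by move=> t; rewrite inE => /orP[/eqP ->|/sz tys]; rewrite inE ?eqxx// tys orbT.
Qed.

Lemma floor_dist (R : realType) (x y : R) (m : int) (k : nat) :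
  Num.floor y = m -> `|x - y| <= k%:R -> (`|Num.floor x - m|%N <= k)%N.
Proof.
move=> <- xy; have /andP[x1 x2] := floor_itv x; have /andP[y1 y2] := floor_itv y.
rewrite intrD in x2; rewrite intrD in y2.
suff : `|Num.floor x - Num.floor y| < k.+1%:Z by lia.
rewrite -(@ltr_int R) intr_norm rmorphB/= -[k.+1]addn1 PoszD intrD -pmulrn.
move: xy; rewrite ler_norml ltr_norml => /andP[? ?]; apply/andP; split; lra.
Qed.

Lemma normr_le_floor (R : realType) (x : R) : `|x| <= `|Num.floor x|%N%:R + 1.
Proof.
have /andP[] := floor_itv x; move: (Num.floor x) => m m1 m2.
have a0 : 0 <= `|m|%N%:R :> R by [].
have : m = `|m|%N%:Z \/ m = - `|m|%N%:Z by lia.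
rewrite ler_norml intrD in m2 *; move: a0; rewrite pmulrn => a0.
by case=> E; rewrite {1}E ?mulrNz in m1; rewrite {1}E ?mulrNz in m2; apply/andP; split; lra.
Qed.

Section deterministic.
Context {R : realType} {d : nat}.
Variables (s : R) (n : nat).
Hypotheses (s0 : 0 < s) (d0 : (0 < d)%N).
Let L := d%:R * s.
Let C := (3 * d + 2)%N.
Implicit Types (eta : configuration R d) (x y z : 'rV[R]_d).

Let dp : 1 <= d%:R :> R. Proof. by rewrite ler1n. Qed.
Let sL : s <= L. Proof. by rewrite ler_peMl// ltW. Qed.
Let m0 : 0 < mesh s n. Proof. exact: mesh_gt0. Qed.
Let ms : mesh s n <= s.
Proof. by rewrite /mesh ler_pdivrMr// ler_peMr ?ler1n// ltW. Qed.

Definition cell_of x : {ffun 'I_d -> int} := [ffun i => Num.floor (x ord0 i / s)].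

Lemma enorm_cell_corner x : enorm (x - \row_i ((cell_of x i)%:~R * s)) <= L.
Proof.
apply: enorm_le_coord (ltW s0) _ => i; rewrite !mxE ffunE.
have : icell s (Num.floor (x ord0 i / s)) (x ord0 i) by [].
move=> /(icellP _ _ s0)/andP[h1]; rewrite intrD mulrDl mul1r => h2.
by rewrite ger0_norm ?subr_ge0// lerBlDl ltW.
Qed.

Lemma exists_bad eta x ys :
  path (eclose (mesh s n)) x ys ->
  (forall z, z \in x :: ys -> exists2 q, eta q & enorm (z - q.1) <= q.2) ->
  4 * L <= enorm (last x ys - x) ->
  exists o, bad L s n o eta /\
    forall i, (`|(cell_of x i - o.1 i)%R|%N <= o.2 + C)%N.
Proof.
move=> pys ballz far; have hm := m0; have hms := ms; have hsL := sL.
set v := cell_of x.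
pose c : 'rV[R]_d := \row_i ((v i)%:~R * s).
have xc : enorm (x - c) <= L by exact: enorm_cell_corner.
have L0 : 0 < L by exact: lt_le_trans sL.
(* If only small balls meet the chain up to its exit from the ball of radius
   [2 L] around [c], it is a local crossing; otherwise a big ball is close. *)
have [||zs [y [pz az yL sub]]] := @path_first_hit _ (eclose (mesh s n))
    (fun z => 2 * L <= enorm (z - c)) x ys pys.
- by rewrite -ltNge; lra.
- have := enorm_triangle c (last x ys) x; rewrite (enormBC c x); lra.
have before z : z \in x :: zs -> enorm (z - c) < 2 * L.
  by move=> /(allP az); rewrite /= -ltNge.
have near z : z \in x :: rcons zs y -> enorm (z - c) <= 2 * L + mesh s n.
  rewrite -rcons_cons mem_rcons inE => /orP[/eqP ->|/before h]; last lra.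
  move: pz; rewrite rcons_path => /andP[_]; rewrite /eclose enormBC => h.
  have := before _ (mem_last x zs).
  have := enorm_triangle (last x zs) y c; lra.
have ballz' z : z \in x :: rcons zs y -> exists2 q, eta q & enorm (z - q.1) <= q.2.
  move=> zx; apply: ballz; move: zx; rewrite !inE => /orP[->//|/sub ->].
  by rewrite orbT.
have [[z [q [zx eq zq sq]]]|small] := pselect (exists z q,
    [/\ z \in x :: rcons zs y, eta q, enorm (z - q.1) <= q.2 & s <= q.2]).
  have k1 : 1 <= Num.floor (q.2 / s) by rewrite floor_ge_int ler_pdivlMr// mul1r.
  pose k := `|Num.floor (q.2 / s)|%N.
  have kE : k%:Z = Num.floor (q.2 / s) by rewrite gez0_abs// (le_trans ler01).
  exists (cell_of q.1, k); split.
    have k0 : (k == 0%N) = false by apply/eqP => k0; move: k1; rewrite -kE k0.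
    rewrite /bad /sat /object_pattern /= k0 ffunE /= k0.
    apply/asboolP; exists q; split=> //; split=> /=.
      by move=> i; rewrite /icell/= ffunE.
    by rewrite /icell/= kE.
  move=> i /=; rewrite ffunE.
  (* Origin of [C]: going from [x] through [c] and [z] to the centre of the big ball costs less than
     [L + (2 * L + mesh s n) + (k + 1) * s], that is at most [3 * d + k + 2] cell sides. *)
  have -> : (k + C = 3 * d + k + 2)%N by rewrite /C addnCA addnA.
  apply: (@floor_dist _ _ (q.1 ord0 i / s)); first by rewrite ffunE.
  rewrite -mulrBl normrM [`|s^-1|]ger0_norm ?invr_ge0 ?(ltW s0)// ler_pdivrMr//.
  have qk : q.2 < k%:R * s + s.
    rewrite -[X in _ + X]mul1r -mulrDl -ltr_pdivrMr//; have /andP[_] := floor_itv (q.2 / s).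
    by rewrite -kE intrD -pmulrn.
  have := normr_le_enorm (x - q.1) i; rewrite !mxE => /le_trans; apply.
  have := enorm_triangle c x q.1; have := enorm_triangle z c q.1.
  have := near z zx; rewrite (enormBC c z).
  have -> : (3 * d + k + 2)%N%:R * s = 3 * L + k%:R * s + 2 * s.
    by rewrite natrD natrD [(3 * d)%N%:R]natrM /L; ring.
  move: xc; lra.
exists (v, 0%N); split; last first.
  by move=> i; rewrite /= subrr.
have -> : bad L s n (v, 0%N) eta = sat (fbox s v) (@crossing_pattern _ _ L s n) eta.
  rewrite /bad /sat /object_pattern /=; congr (is_true (crossing_pattern _ _ _)).
  by apply/ffunP => t; rewrite !ffunE /=.
apply: recenter_crossing_sat => //.
exists (x - c), [seq z - c | z <- rcons zs y]; split => //.
- rewrite (_ : last _ _ = last x (rcons zs y) - c); first by rewrite last_rcons.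
  exact: (last_map (fun z => z - c)).
- rewrite (_ : path _ _ _ = path (relpre (fun z => z - c) (eclose (mesh s n))) x (rcons zs y)); last first.
    exact: (@path_map _ _ (fun z => z - c) (eclose (mesh s n)) x (rcons zs y)).
  apply: sub_path pz => a b; rewrite /= /eclose.
  by rewrite opprB addrA subrK.
- move=> _ /(@mapP _ _ (fun z => z - c) (x :: rcons zs y))[z zx ->].
  have [q eq zq] := ballz' z zx.
  have qs : q.2 < s by rewrite ltNge; apply/negP => sq; apply: small; exists z, q.
  exists (q.1 - c, q.2); split.
  + by rewrite /recenter/= subrK -surjective_pairing.
  + split=> /=; last by rewrite qs (le_trans (enorm_ge0 _) zq).
    move=> i; rewrite sub0r add0r mulrNz mulNr.
    have E : (4 * d)%N%:~R * s = 4 * L :> R by rewrite -pmulrn natrM /L mulrA.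
    (* The distance is below [2 * L + mesh s n + s], and both the mesh and [s] are at most [L]. *)
    have : `|(q.1 - c) ord0 i| < 4 * L.
      apply: le_lt_trans (normr_le_enorm _ _) _.
      have := enorm_triangle z q.1 c; have := near z zx.
      rewrite (enormBC q.1 z); lra.
    by rewrite E ltr_norml => /andP[/ltW -> ->].
  + by rewrite /= opprB addrA subrK (le_trans zq)// lerDl ltW.
Qed.

Lemma eclose_cell x y i : eclose (mesh s n) x y ->
  (`|(cell_of x i - cell_of y i)%R|%N <= 1)%N.
Proof.
move=> xy; rewrite [cell_of x i]ffunE; apply: (@floor_dist _ _ (y ord0 i / s)).
  by rewrite ffunE.
rewrite -mulrBl normrM [`|s^-1|]ger0_norm ?invr_ge0 ?(ltW s0)// ler_pdivrMr// mul1r.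
have := normr_le_enorm (x - y) i; rewrite !mxE => /le_trans; apply.
exact: le_trans xy ms.
Qed.

(** The ends of the chain are at least [8 * L] apart, so one of them is at distance at least [4 * L]
    from [x]. The part between [x] and that end is used, reversed when the end is 0. *)
Lemma exists_bad_on_chain eta p (r : R) :
  path (eclose (mesh s n)) 0 p -> enorm (last 0 p) = r -> 8 * L <= r ->
  (forall z, z \in 0 :: p -> exists2 q, eta q & enorm (z - q.1) <= q.2) ->
  forall x, x \in 0 :: p -> exists o, bad L s n o eta /\
    forall i, (`|(cell_of x i - o.1 i)%R|%N <= o.2 + C)%N.
Proof.
move=> pp lr Lr ballp x xp; move: pp lr ballp; case/splitPl: xp => p1 p2 lx pp lr ballp.
move: pp lr; rewrite cat_path last_cat lx => /andP[pp1 pp2] lr.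
have [far|far] := leP (4 * L) (enorm (last x p2 - x)).
  apply: exists_bad pp2 _ far => z; rewrite inE => zx; apply: ballp.
  rewrite -cat_cons mem_cat; case/orP: zx => [/eqP ->|->]; last by rewrite orbT.
  by rewrite -lx mem_last.
apply: (@exists_bad eta x (rev (belast 0 p1))).
- rewrite -lx rev_path; apply: sub_path pp1 => a b /=.
  by rewrite /eclose enormBC.
- move=> z; rewrite inE mem_rev => zx; apply: ballp; rewrite -cat_cons mem_cat.
  apply/orP; left; case/orP: zx => [/eqP ->|/mem_belast//].
  by rewrite -lx mem_last.
have -> : last x (rev (belast 0 p1)) = 0.
  by rewrite -lx; case: (p1) => //= a p1'; rewrite rev_cons last_rcons.
rewrite sub0r enormN; have := enorm_triangle x (last x p2) 0.
rewrite !subr0 lr; lra.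
Qed.

(** The tolerances telescope. The last radius is added on the left because the end point of the path
    may lie that far from the last object. *)
Lemma linked_path_reach (o : @object d) q i : path (linked C) o q ->
  (`|((last o q).1 i - o.1 i)%R| + (last o q).2 <= total_reach C q + o.2)%N.
Proof.
elim: q o => [|o' q IH] o /=; first by rewrite subrr /total_reach big_nil.
move=> /andP[/linkedP/(_ i) oo' /IH]; rewrite /total_reach big_cons /reach.
move: (\sum_(j <- q) _)%N (last o' q).2 ((last o' q).1 i) (o'.1 i) (o.1 i) oo' => S a A B D.
move: o.2 o'.2 => e e'; rewrite -!muln2; move: (C * 2)%N => c; lia.
Qed.

Lemma connection_chain eta (r : R) (rho : nat) :
  8 * L <= r -> (rho + C + 2)%:R * L < r ->
  connection [set 0] (sphere 0 r) eta ->
  exists q, [/\ path (linked C) origin q, uniq q,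
    forall o, o \in q -> bad L s n o eta & (rho <= total_reach C q)%N].
Proof.
move=> Lr rhor [_ [y [-> yr /(path_connected_in_sample m0)[p [pp lp Op]]]]].
have ballp z : z \in 0 :: p -> exists2 q, eta q & enorm (z - q.1) <= q.2.
  by move=> /Op[q eq zq]; exists q.
have lr : enorm (last 0 p) = r by rewrite lp -yr subr0.
have H := exists_bad_on_chain pp lr Lr ballp.
have Hx : forall x, exists o, x \in 0 :: p -> bad L s n o eta /\
    forall i, (`|(cell_of x i - o.1 i)%R|%N <= o.2 + C)%N.
  move=> x; have [xp|xp] := boolP (x \in 0 :: p); last by exists origin.
  by have [b hb] := H x xp; exists b.
have [f fP] := choice Hx.
have pO : path (linked C) origin (map f (0 :: p)).
  have f0 := fP 0 (mem_head _ _).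
  rewrite /= path_map; apply/andP; split.
    apply/linkedP => i; have := f0.2 i; rewrite !ffunE mxE mul0r floor0 /=; lia.
  apply: (sub_in_path (P := mem (0 :: p))) pp; last exact/allP.
  move=> a b ap bp ab; apply/linkedP => i.
  have := (fP a ap).2 i; have := (fP b bp).2 i; have := eclose_cell i ab.
  rewrite -muln2; move: (cell_of a i) (cell_of b i) ((f a).1 i) ((f b).1 i) (f a).2 (f b).2.
  move: C => c; clear; lia.
have lO : last origin (map f (0 :: p)) = f y by rewrite /= last_map lp.
have : {subset map f (0 :: p) <= map f (0 :: p)} by [].
(* Erasing loops makes the objects distinct, as the union bound requires, and keeps the last one.
   [origin] is only the root of the chain and may fail to be bad. *)
case/shortenP: pO lO => q pq uq sq lq _.
exists q; split=> //.
- by case/andP: uq.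
- move=> o /sq; move=> /mapP[x xp ->]; exact: (fP x xp).1.
have yp : y \in 0 :: p by rewrite -lp mem_last.
have [i yi] : exists i, (rho + C + 2)%:R * s < `|y ord0 i|.
  apply: contrapT => /forallNP h.
  have : enorm y <= d%:R * ((rho + C + 2)%:R * s).
    apply: enorm_le_coord => [|i]; first by rewrite mulr_ge0// ltW.
    by rewrite leNgt; apply/negP/h.
  by rewrite -lp lr mulrCA leNgt rhor.
have cy : (rho + C < `|cell_of y i|)%N.
  rewrite ffunE -(ltr_nat R).
  have : (rho + C + 2)%:R < `|y ord0 i / s|.
    by rewrite normrM [`|s^-1|]ger0_norm ?invr_ge0 ?(ltW s0)// ltr_pdivlMr.
  have := normr_le_floor (y ord0 i / s).
  rewrite natrD; move: (rho + C)%:R `|_|%N%:R `|_| => a b c; lra.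
have := (fP y yp).2 i; have := linked_path_reach i pq; rewrite lq /= ffunE subr0.
rewrite addn0; move: (total_reach C q) (cell_of y i) ((f y).1 i) ((f y).2) cy => S A B e.
move: C => c; clear; lia.
Qed.

End deterministic.

(** * Choice of the constants and conclusion *)

Lemma exp_decay_of_dyadic (R : realType) (f : R -> \bar R) (q L : R) (C : nat) :
  q < 1 -> 0 < L -> (forall r, (f r <= q%:E)%E) ->
  (forall r (rho : nat), 8 * L <= r -> (rho + C + 2)%:R * L < r ->
    (f r <= (2 / 2 ^+ rho)%:E)%E) ->
  exists c : R, 0 < c /\ forall r : R, 1 <= r -> (f r <= (expR (- (c * r)))%:E)%E.
Proof.
move=> q1 L0 fq fL; pose Q := Num.max q 2^-1.
have Q0 : 0 < Q by rewrite lt_max invr_gt0 ltr0n orbT.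
have Q1 : Q < 1 by rewrite gt_max q1 invf_lt1 ?ltr1n.
(* With [N] the integer part of [r / L], the choice of [N./2 + 1] for [rho] requires
   [N./2 + C + 3 < N] and [8 <= N], which hold from [N0] on. *)
pose N0 := (2 * C + 12)%N; pose r1 := N0%:R * L.
have r10 : 0 < r1 by rewrite mulr_gt0// ltr0n addn_gt0 orbT.
have lQ : ln Q < 0 by apply: ln_lt0; rewrite Q0.
(* The second rate turns the constant bound [Q] into decay for [r < r1]. For [r >= r1] the bound is
   at most [expR (- 2^-1) ^+ N./2] with [N./2 >= (r / L - 2) / 2], and [(r / L - 2) / 4] is at least
   [r / (8 * L)]. *)
pose c := Num.min ((8 * L)^-1) (- ln Q / r1).
exists c; split.
  by rewrite lt_min invr_gt0 mulr_gt0//= divr_gt0// oppr_gt0.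
move=> r r1'; have r0 : 0 < r by exact: lt_le_trans r1'.
have cmin (x : R) : c <= x -> expR (- (x * r)) <= expR (- (c * r)).
  by move=> cx; rewrite ler_expR lerN2 ler_wpM2r// ltW.
have [rr|rr] := ltP r r1.
  apply: le_trans (fq r) _; rewrite lee_fin.
  apply: (@le_trans _ _ Q); first by rewrite le_max lexx.
  apply: le_trans (cmin (- ln Q / r1) _); last by rewrite ge_min lexx orbT.
  rewrite -[leLHS](lnK Q0) ler_expR mulrAC !mulNr opprK -mulrA.
  by rewrite -[leLHS]mulr1 ler_wnM2l ?(ltW lQ)// ler_pdivrMr// mul1r ltW.
have rL : N0%:R <= r / L by rewrite ler_pdivlMr.
have f0 : 0 <= Num.floor (r / L).
  by rewrite floor_ge_int; apply: le_trans rL.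
pose N := `|Num.floor (r / L)|%N.
have NE : (N%:R : R) = (Num.floor (r / L))%:~R by rewrite -[in RHS](gez0_abs f0).
have /andP[N1 N2] := floor_itv (r / L); rewrite intrD -NE in N1 N2.
have N0N : (N0 <= N)%N.
  by rewrite -ltnS -(ltr_nat R) -[N.+1]addn1 natrD; apply: le_lt_trans rL _.
have rN : N%:R * L <= r by rewrite -ler_pdivlMr.
have h2 : ((N./2).+1 + C + 2 < N)%N.
  move: N0N; rewrite /N0; move: (N) => k; clear; lia.
have := fL r (N./2).+1; rewrite (_ : 8 * L <= r) => [/(_ isT)|]; last first.
  apply: le_trans rN; rewrite ler_pM2r// ler_nat.
  by move: N0N; rewrite /N0; move: (N) => k; clear; lia.
rewrite (_ : _ * L < r) => [/(_ isT)|]; last first.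
  by apply: lt_le_trans rN; rewrite ltr_pM2r// ltr_nat.
move=> /le_trans; apply; rewrite lee_fin.
apply: le_trans (cmin ((8 * L)^-1) _); last by rewrite ge_min lexx.
rewrite exprS invfM mulrA divff ?pnatr_eq0// mul1r.
apply: (@le_trans _ _ (expR (- 2^-1) ^+ N./2)).
  rewrite -exprVn lerXn2r ?nnegrE ?invr_ge0 ?expR_ge0//.
  by have := expR_ge1Dx (- (2^-1 : R)); apply: le_trans; lra.
rewrite -expRM_natl ler_expR mulrN lerN2.
have h3 : (r / L - 2) / 2 <= (N./2)%:R.
  have : N%:R <= (N./2).*2.+1%:R :> R.
    by rewrite ler_nat; move: (N) => k; clear; lia.
  rewrite -[_.*2.+1]addn1 -muln2 natrD natrM; lra.
have h4 : 12 <= r / L by apply: le_trans rL; rewrite ler_nat leq_addl.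
rewrite invfM -mulrA [L^-1 * r]mulrC.
have : (N./2)%:R * 2^-1 = (N./2)%:R / 2 :> R by [].
move: ((N./2)%:R) (r / L) h3 h4 => x y h3 h4 _; lra.
Qed.

(** Half of the exponential absorbs [s ^+ d], as [x <= expR x] for [x = c * s / (2 * d)]; the other
    half is at most [w * W / A'] once [s] is large. Since [0 < k], at least one such factor is
    present to cancel [A'] and to supply [w]. *)
Lemma exists_scale_weight_le (R : realType) (d : nat) (c A w : R) :
  (0 < d)%N -> 0 < c -> 0 <= A -> 0 < w <= 1 -> forall W : R, 0 < W <= 1 ->
  exists2 s0 : R, 1 <= s0 & forall s, s0 <= s -> forall k, (0 < k)%N ->
    A * (s ^+ d * expR (- (c * s)) ^+ k) <= w * W ^+ k.
Proof.
move=> d0 c0 A0 /andP[w0 w1] W /andP[W0 W1].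
have dp : 0 < d%:R :> R by rewrite ltr0n.
pose A' := Num.max 1 (A * (2 * d%:R / c) ^+ d).
have A'1 : 1 <= A' by rewrite le_max lexx.
have A'0 : 0 < A' by exact: lt_le_trans A'1.
have c2 : 0 < c / 2 by rewrite divr_gt0.
have B1 : 1 <= A' / (w * W).
  by rewrite ler_pdivlMr ?mulr_gt0// mul1r (le_trans _ A'1)// mulr_ile1 ?(ltW w0) ?(ltW W0).
have [s0 s01 es] := exists_scale_expR_le c2 B1; exists s0 => // s ss0 k k0.
have sp : 0 < s by apply: lt_le_trans ss0; exact: lt_le_trans s01.
have {es} := es s ss0; rewrite invf_div => es.
have sd : s ^+ d <= (2 * d%:R / c) ^+ d * expR (c / 2 * s).
  have -> : expR (c / 2 * s) = expR (c / 2 * s / d%:R) ^+ d.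
    by rewrite -expRM_natl; congr expR; field; rewrite gt_eqF.
  rewrite -exprMn lerXn2r ?nnegrE ?mulr_ge0 ?invr_ge0 ?expR_ge0 ?(ltW sp) ?(ltW c0)//.
  apply: (@le_trans _ _ (2 * d%:R / c * (c / 2 * s / d%:R))).
    rewrite le_eqVlt; apply/orP; left; apply/eqP; field.
    by rewrite !gt_eqF.
  rewrite ler_wpM2l ?divr_ge0 ?mulr_ge0 ?(ltW c0)//.
  by have := expR_ge1Dx (c / 2 * s / d%:R); apply: le_trans; rewrite lerDr.
have e2 : expR (c / 2 * s) * expR (- (c * s)) ^+ k <= expR (- (c / 2 * s)) ^+ k.
  have -> : - (c * s) = - (c / 2 * s) + - (c / 2 * s) by field.
  rewrite expRD exprMn mulrA -[leRHS]mul1r ler_wpM2r ?exprn_ge0 ?expR_ge0//.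
  rewrite expRN exprVn ler_pdivrMr ?exprn_gt0 ?expR_gt0// mul1r.
  by rewrite -[leLHS]expr1 ler_weXn2l// -[leLHS]expR0 ler_expR mulr_ge0 ?(ltW c2) ?(ltW sp).
apply: (@le_trans _ _ (A' * expR (- (c / 2 * s)) ^+ k)).
  apply: (@le_trans _ _ ((A * (2 * d%:R / c) ^+ d) * expR (- (c / 2 * s)) ^+ k)).
    rewrite -!mulrA ler_wpM2l//.
    apply: (@le_trans _ _ ((2 * d%:R / c) ^+ d * expR (c / 2 * s) * expR (- (c * s)) ^+ k)).
      by rewrite ler_wpM2r ?exprn_ge0 ?expR_ge0.
    by rewrite -!mulrA in e2 *; rewrite ler_wpM2l// exprn_ge0// !mulr_ge0 ?invr_ge0 ?(ltW c0).
  by rewrite ler_wpM2r ?exprn_ge0 ?expR_ge0// le_max lexx orbT.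
apply: (@le_trans _ _ (A' * (w * W / A') ^+ k)).
  rewrite ler_wpM2l ?(ltW A'0)// lerXn2r ?nnegrE ?expR_ge0//.
  by rewrite divr_ge0 ?mulr_ge0 ?ltW.
rewrite mulrAC exprMn mulrA ler_wpM2r ?exprn_ge0 ?(ltW W0)//.
case: k k0 {e2} => // k _; rewrite exprS mulrCA !mulrA divfK ?gt_eqF//.
rewrite -[leRHS]mulr1 ler_wpM2l ?(ltW w0)// exprn_ile1 ?divr_ge0 ?(ltW w0) ?(ltW A'0)//.
by rewrite ler_pdivrMr// mul1r (le_trans w1).
Qed.

Theorem theorem2 (R : realType) (d : nat) (hd : (2 <= d)%N)
    (mu : {finite_measure set R -> \bar R})
    (mu_nonneg : mu `]-oo, 0[%classic = 0%E)
    (P : R -> probability (configuration R d) R)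
    (P_poisson : forall l : R, 0 <= l ->
       is_poisson_process (boolean_intensity mu l) (P l))
    (mu_tail : exists c : R, 0 < c /\
       forall r : R, 1 <= r -> (mu `[r, +oo[%classic <= (expR (- (c * r)))%:E)%E)
    (l : R) (hl : 0 <= l) (l_subcritical : (l%:E < lambda_c_tilde P)%E) :
  exists c : R, 0 < c /\
    forall r : R, 1 <= r -> (theta P r l <= (expR (- (c * r)))%:E)%E.
Proof.
have d0 : (0 < d)%N by exact: ltn_trans hd.
have dp : 0 < d%:R :> R by rewrite ltr0n.
have HP := P_poisson l hl; have {mu_tail} [c [c0 mu_tail]] := mu_tail.
(* The lower bound at bounded scales rests on balls of positive radius; the models without them are
   settled here. *)
have [nul|] := pselect (l = 0 \/ mu `]0, +oo[%classic = 0%E).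
  exists 1; split=> // r _; rewrite /theta (Pr_connection0_null HP d0 _ nul).
  by rewrite lee_fin expR_ge0.
move=> /not_orP[/eqP l0 /eqP mu0].
have lp : 0 < l by rewrite lt_neqAle eq_sym l0.
have [rho rho0 murho] := exists_charged_radius mu0.
pose C := (3 * d + 2)%N; pose K := ((8 * d).+1 ^ d)%N.
pose wf : R := weight_factor C (d := d).
have wf0 : 0 < wf by exact: weight_factor_gt0.
have wf1 : wf <= 1.
  by rewrite invf_le1 ?ltr0n ?ler1n ?muln_gt0 ?expn_gt0 ?addn_gt0 ?orbT.
pose W : R := (8 * (2 ^ d) ^ 2)%N%:R^-1.
have W0 : 0 < W by rewrite invr_gt0 ltr0n muln_gt0 !expn_gt0.
have W1 : W <= 1 by rewrite invf_le1 ?ltr0n ?ler1n ?muln_gt0 ?expn_gt0.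
(* The [K]-th powers answer the [K]-th root taken in [all_bad_le]; the intensity [l] plays the part
   of [A]. *)
have [||s0 s01 small] := @exists_scale_weight_le R d c l (wf ^+ K) d0 c0 hl _ (W ^+ K) _.
- by rewrite exprn_gt0//= exprn_ile1// ltW.
- by rewrite exprn_gt0//= exprn_ile1// ltW.
have L00 : 0 < d%:R * s0 by rewrite mulr_gt0// (lt_le_trans ltr01).
have [a a0 lower] := connection_lower_bound hl HP d0 lp rho0 L00 murho.
(* Otherwise the crossing probabilities would be bounded below by a positive number, [l] would
   belong to the set defining [lambda_c_tilde], and it could not be below the infimum. *)
have [L [L0 L_small]] : exists L : R, 0 < L /\
    (Pr (P l) (connection (cball 0 L) (sphere 0 (2 * L))) < (Num.min a (wf ^+ K))%:E)%E.
  apply: contrapT => h; move: l_subcritical; rewrite ltNge => /negP; apply.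
  apply: ereal_inf_lbound; exists l => //; split=> //.
  apply: (@lt_le_trans _ _ (Num.min a (wf ^+ K))%:E).
    by rewrite lte_fin lt_min a0 exprn_gt0.
  apply: le_ereal_inf_tmp => _ [r /= r0 <-]; rewrite leNgt; apply/negP => rs.
  by apply: h; exists r.
have LL : d%:R * s0 < L.
  rewrite ltNge; apply/negP => Ls.
  have /(le_lt_trans (lower L _)) : (Pr (P l) (connection (cball 0 L) (sphere 0 (2 * L))) < a%:E)%E.
    by apply: lt_le_trans L_small _; rewrite lee_fin ge_min lexx.
  by rewrite ltxx L0 Ls => /(_ isT).
pose s := L / d%:R.
have ss0 : s0 <= s by rewrite ler_pdivlMr// mulrC ltW.
have s1 : 1 <= s by exact: le_trans ss0.
have sp : 0 < s by exact: lt_le_trans s1.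
have LE : L = d%:R * s by rewrite mulrC divfK ?gt_eqF.
have [n Pn] := crossing_pattern_small HP sp (ltW L0) d0 L_small.
have hbad o : (P l (bad L s n o) <= (@weight R d C o ^+ K)%:E)%E.
  rewrite /weight -/wf -/W exprMn -[(W ^+ _) ^+ _]exprM mulnC exprM.
  have [ho2|ho2] := posnP o.2.
    rewrite ho2 expr0 mulr1; apply: (P_bad_small sp hl HP ho2).
    by apply: lt_le_trans Pn _; rewrite lee_fin ge_min lexx orbT.
  apply: le_trans (P_bad_big L n sp hl HP ho2) _.
  rewrite lee_fin; apply: le_trans (small s ss0 _ ho2).
  rewrite ler_wpM2l// ler_wpM2l ?exprn_ge0 ?(ltW sp)//.
  exact (fine_mu_icell_le mu_tail s1 ho2).
have chain := @chain_le R d C _ (mu_ext (P l)) (bad L s n)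
  (fun os uos => all_bad_le sp d0 HP uos (@weight_ge0 R d C) hbad).
have [q q1 thq] := Pr_connection0_lt1 hl HP c0 mu_tail.
apply: (exp_decay_of_dyadic (f := fun r => theta P r l) (C := C) q1 L0).
  by move=> r; exact: thq.
move=> r m Lr mr; apply: le_trans (chain m); apply: le_mu_ext => eta.
by rewrite LE in Lr mr *; exact: connection_chain.
Qed.
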